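(* Let $H=\sum_{X\in S}\lambda_Xh_X$ be a local Hamiltonian whose interaction graph has maximum degree $\mathfrak{d}\ge1$, and let $\rho$ be any quantum state. Consider an operator $A$ for which $\mathrm{supp}(A)\in S$, and let $t\in\mathbb{C}$ with $|t|<t^*=1/(2e\mathfrak{d})$. Then for every integer $M\ge0$, $$\left|\langle A(t)\rangle-\langle A(0)\rangle-\sum_{m=1}^M\sum_{\mathbf{W}\in\mathcal{G}_m^A}\frac{\lambda^{\mathbf{W}}}{\mathbf{W}!}\,\mathcal{D}_{\mathbf{W}}\langle A(t)\rangle\right|\le e\,\mathfrak{d}\,\|A\|\,\frac{(|t|/t^* )^{M+1}}{1-|t|/t^*},$$ where $\langle A(t)\rangle=\mathrm{tr}(e^{iHt}Ae^{-iHt}\rho)$.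
   Context: Setting. $V$ is a set of $n$ spins; each $v\in V$ carries a Hilbert space $\mathcal{H}^v$ of dimension $d$, and $\mathcal{H}=\bigotimes_{v\in V}\mathcal{H}^v$. A subsystem is a subset $X\subseteq V$. The support $\mathrm{supp}(B)$ of a linear operator $B$ on $\mathcal{H}$ is the smallest subsystem on which $B$ acts nontrivially. $S$ is a set of subsystems and $H=\sum_{X\in S}\lambda_X h_X$, where $\lambda_X\in\mathbb{R}$, $|\lambda_X|\le1$, and $h_X$ is Hermitian with $\mathrm{supp}(h_X)=X$ and operator norm $\|h_X\|=1$; $H$ is $k$-local, i.e. $|X|\le k$ for all $X\in S$, for some fixed $k$. The interaction graph is the simple graph with vertex set $S$ in which two distinct $X,Y\in S$ are joined by an edge iff $X\cap Y\ne\emptyset$; $\mathfrak{d}$ is its maximum degree. Clusters. A cluster $\mathbf{W}$ is a nonempty finite multiset of elements of $S$; $\mu_{\mathbf{W}}(X)$ is the multiplicity of $X\in S$ in $\mathbf{W}$, and $|\mathbf{W}|=\sum_X\mu_{\mathbf{W}}(X)$. The cluster graph $G_{\mathbf{W}}$ has one vertex for each element of $\mathbf{W}$, counted with multiplicity, and two distinct vertices are adjacent iff their subsystems intersect (so copies of the same subsystem are adjacent). The union of clusters adds multiplicities. $\mathbf{W}$ is completely connected to $A$ if the graph $G_{\mathbf{W}\cup\{\mathrm{supp}(A)\}}$ is connected; $\mathcal{G}_m^A$ is the set of clusters of size $|\mathbf{W}|=m$ completely connected to $A$. Put $\lambda^{\mathbf{W}}=\prod_{X\in S}\lambda_X^{\mu_{\mathbf{W}}(X)}$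 and $\mathbf{W}!=\prod_{X\in S}\mu_{\mathbf{W}}(X)!$. For a function $f$ of the parameters $\lambda=(\lambda_X)_{X\in S}$, the cluster derivative is $$\mathcal{D}_{\mathbf{W}}f=\left.\left[\prod_{X\in S}\left(\frac{\partial}{\partial\lambda_X}\right)^{\mu_{\mathbf{W}}(X)}\right]f(\lambda)\right|_{\lambda=0}.$$ $\langle A(t)\rangle$ is regarded as a function of $\lambda$ for fixed $t$, $A$, $\rho$ and $h_X$. *)

(* Defs.v *)
From HB Require Import structures.
From mathcomp Require Import all_boot all_order all_algebra.
From mathcomp Require Import finmap multiset.
From mathcomp Require Import all_classical all_reals all_analysis.
From mathcomp.real_closed Require Import complex.

Set Implicit Arguments.
Unset Strict Implicit.
Unset Printing Implicit Defensive.

Import Order.TTheory GRing.Theory Num.Theory numFieldNormedType.Exports.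
Import Normc.

Local Open Scope ring_scope.
Local Open Scope sesquilinear_scope.
Local Open Scope complex_scope.
Local Open Scope classical_set_scope.

(* The Hilbert space attached to a finite set V of d-level spins is the
   tensor product over V of copies of C^d; its product basis is indexed by the
   configurations {ffun V -> 'I_d}, and an operator is its matrix in that
   basis, acting on column vectors. *)
Notation config V d := {ffun V -> 'I_d}.
Notation hvec R V d := 'cV[R[i]]_#|{: config V d}|.
Notation op R V d := 'M[R[i]]_#|{: config V d}|.

Definition vnorm (R : realType) (N : nat) (v : 'cV[R[i]]_N) : R :=
  Num.sqrt (\sum_i normc (v i ord0) ^+ 2).

Definition opnorm (R : realType) (N : nat) (B : 'M[R[i]]_N) : R :=
  sup [set vnorm (B *m v) | v in [set v : 'cV[R[i]]_N | vnorm v <= 1]].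

(* The limit is taken entrywise, in the usual topology of R[i]. *)
Definition expmx (R : realType) (N : nat) (B : 'M[R[i]]_N) : 'M[R[i]]_N :=
  \matrix_(i, j)
    (limn (fun K => (\sum_(p < K) (p`!%:R)^-1 *: (B ^+ p : 'M[R[i]]_N)) i j
                    : R[i]^o) : R[i]).

Definition is_state (R : realType) (N : nat) (rho : 'M[R[i]]_N) : Prop :=
  [/\ rho \is hermsymmx,
      forall v : 'cV[R[i]]_N, 0 <= (v ^t* *m rho *m v) ord0 ord0 &
      \tr rho = 1].

Definition restrict_config (V : finType) (d : nat) (X : {set V})
    (s : config V d) : config {v | v \in X} d :=
  [ffun v => s (val v)].

(* embed b is the tensor product of b, acting on the spins of X, with the
   identity on the spins outside X. *)
Definition embed (R : realType) (V : finType) (d : nat) (X : {set V})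
    (b : op R {v | v \in X} d) : op R V d :=
  \matrix_(i, j)
    let s : config V d := enum_val i in
    let s' : config V d := enum_val j in
    if [forall v, (v \notin X) ==> (s v == s' v)]
    then b (enum_rank (restrict_config X s)) (enum_rank (restrict_config X s'))
    else 0.

Definition acts_within (R : realType) (V : finType) (d : nat)
    (B : op R V d) (X : {set V}) : Prop :=
  exists b : op R {v | v \in X} d, B = embed b.

(* The intersection below is itself one of the X's (acts_within_supp), hence
   the smallest of them. *)
Definition supp (R : realType) (V : finType) (d : nat) (B : op R V d)
    : {set V} :=
  \bigcap_(X : {set V} | `[< acts_within B X >]) X.

Section SuppSmallest.
Context (R : realType) (V : finType) (d : nat).
Implicit Types (B : op R V d) (X Y : {set V}) (s : config V d).

Lemma supp_min B X : acts_within B X -> (supp B \subset X)%SET.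
Proof. by move=> BX; apply: (finset.bigcap_inf X); apply/asboolP. Qed.

Let mix s0 X s : config V d := [ffun v => if v \in X then s v else s0 v].
Let agree X s s' := [forall v, (v \notin X) ==> (s v == s' v)].

Lemma acts_withinP (s0 : config V d) B X :
  acts_within B X <->
  forall s s', B (enum_rank s) (enum_rank s') =
    if agree X s s' then B (enum_rank (mix s0 X s)) (enum_rank (mix s0 X s'))
    else 0.
Proof.
split=> [[b ->] s s'|BX].
  rewrite !mxE !enum_rankK /= -/(agree X s s').
  case: ifP => // _; rewrite ifT; last first.
    by apply/forallP => v; apply/implyP => /negbTE vX; rewrite !ffunE vX.
  by congr (b (enum_rank _) (enum_rank _)); apply/ffunP => v;
     rewrite !ffunE (valP v).
pose ext (r : config {v | v \in X} d) : config V d :=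
  [ffun v => if insub v is Some x then r x else s0 v].
have extE s : ext (restrict_config X s) = mix s0 X s.
  apply/ffunP => v; rewrite !ffunE; case: insubP => [x vX xv|/negbTE -> //].
  by rewrite ffunE xv vX.
exists (\matrix_(i, j) B (enum_rank (ext (enum_val i)))
                         (enum_rank (ext (enum_val j)))).
apply/matrixP => i j; rewrite -{1}(enum_valK i) -{1}(enum_valK j) BX !mxE /=.
rewrite -/(agree X _ _); case: ifP => // _.
by rewrite mxE !enum_rankK !extE.
Qed.

Lemma acts_withinT B : acts_within B [set: V]%SET.
Proof.
have [i0 _|noidx] := pickP (fun i : 'I_#|{: config V d}| => true); last first.
  by exists 0; apply/matrixP => i; have := noidx i.
apply: (@acts_withinP (enum_val i0) _ _).2 => s s'; rewrite ifT; last first.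
  by apply/forallP => v; rewrite finset.in_setT.
by congr (B (enum_rank _) (enum_rank _)); apply/ffunP => v;
   rewrite !ffunE finset.in_setT.
Qed.

Lemma acts_withinI B X Y :
  acts_within B X -> acts_within B Y -> acts_within B (X :&: Y)%SET.
Proof.
have [i0 _|noidx] := pickP (fun i : 'I_#|{: config V d}| => true); last first.
  by move=> _ _; exists 0; apply/matrixP => i; have := noidx i.
set s0 : config V d := enum_val i0.
move=> /(@acts_withinP s0 _ _).1 BX /(@acts_withinP s0 _ _).1 BY.
apply: (@acts_withinP s0 _ _).2 => s s'.
case: ifP => [/forallP ag|/negbT/forallPn[v]].
  have ag1 v : v \notin (X :&: Y)%SET -> s v = s' v.
    by move=> vXY; apply/eqP/(implyP (ag v)).
  rewrite BX ifT; last first.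
    apply/forallP => v; apply/implyP => /negbTE vX; apply/eqP/ag1.
    by rewrite inE vX.
  rewrite BY ifT; last first.
    apply/forallP => v; apply/implyP => /negbTE vY; rewrite !ffunE.
    by case: ifP => // vX; rewrite ag1// inE vX vY.
  by congr (B (enum_rank _) (enum_rank _)); apply/ffunP => v;
     rewrite !ffunE inE; do 2 case: (v \in _).
rewrite negb_imply inE negb_and => /andP[/orP[]vn ss'].
- rewrite BX ifF//; apply/negbTE/forallPn; exists v.
  by rewrite negb_imply vn.
- rewrite BY ifF//; apply/negbTE/forallPn; exists v.
  by rewrite negb_imply vn.
Qed.

Lemma acts_within_supp B : acts_within B (supp B).
Proof.
rewrite /supp; elim/big_ind: _ => [|X Y|X /asboolP//].
- exact: acts_withinT.
- exact: acts_withinI.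
Qed.

End SuppSmallest.

Definition meets (V : finType) (X Y : {set V}) : bool :=
  (X :&: Y != finset.set0)%SET.

Definition interaction_degree (V : finType) (S : {set {set V}}) : nat :=
  \max_(X in S) #|[set Y in S | (Y != X) && meets X Y]%SET|.

Definition local_hamiltonian (R : realType) (V : finType) (d k : nat)
    (S : {set {set V}}) (lambda : {set V} -> R) (h : {set V} -> op R V d)
    : Prop :=
  forall X, X \in S ->
    [/\ (#|X| <= k)%N, `|lambda X| <= 1, h X \is hermsymmx,
        supp (h X) = X & opnorm (h X) = 1].

(* The families lambda and h are indexed by all of {set V}; only their values
   on S are ever used. *)
Definition hamiltonian (R : realType) (V : finType) (d : nat)
    (S : {set {set V}}) (h : {set V} -> op R V d) (lambda : {set V} -> R)
    : op R V d :=
  \sum_(X in S) (lambda X)%:C *: h X.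

Definition evolved_mean (R : realType) (V : finType) (d : nat)
    (S : {set {set V}}) (h : {set V} -> op R V d) (rho A : op R V d)
    (t : R[i]) (lambda : {set V} -> R) : R[i] :=
  let H := hamiltonian S h lambda in
  \tr (expmx ('i%C * t *: H) *m A *m expmx (- ('i%C * t) *: H) *m rho).

Local Open Scope mset_scope.

Definition cluster (V : finType) (S : {set {set V}}) (W : {mset {set V}})
    : Prop :=
  W != mset0 /\ {in W, forall X, X \in S}.

(* The vertices are the positions in the enumeration of W with multiplicity. *)
Definition cluster_adj (V : finType) (W : {mset {set V}}) : rel 'I_(size W) :=
  fun i j =>
    (i != j) && meets (nth finset.set0 W i) (nth finset.set0 W j).

Definition completely_connected (V : finType) (W : {mset {set V}})
    (X : {set V}) : Prop :=
  forall i j, connect (@cluster_adj V (W `+` [mset X])) i j.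

Definition connected_clusters (V : finType) (S : {set {set V}}) (X : {set V})
    (m : nat) : set {mset {set V}} :=
  [set W | [/\ cluster S W, size W = m & completely_connected W X]].

Lemma finite_connected_clusters (V : finType) (S : {set {set V}})
    (X : {set V}) (m : nat) : finite_set (connected_clusters S X m).
Proof.
apply: (@sub_finite_set _ _
  ((fun s : m.-tuple {set V} => seq_mset s) @` setT)).
  move=> W [_ /eqP Wm _] /=; exists (Tuple Wm) => //.
  exact: seq_mset_id.
exact/finite_image/finite_finset.
Qed.

Definition cluster_coef (R : realType) (V : finType) (S : {set {set V}})
    (lambda : {set V} -> R) (W : {mset {set V}}) : R :=
  \prod_(X in S) lambda X ^+ W X.

Definition cluster_fact (V : finType) (S : {set {set V}})
    (W : {mset {set V}}) : nat :=
  (\prod_(X in S) (W X)`!)%N.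

(* Partial derivative of a complex-valued function of real parameters,
   computed on the real and imaginary parts. *)
Definition pderiv (R : realType) (V : finType) (X : {set V})
    (f : ({set V} -> R) -> R[i]) (lambda : {set V} -> R) : R[i] :=
  let g s := f (fun Y => if Y == X then s else lambda Y) in
  (fun s => complex.Re (g s))^`() (lambda X) +i*
  (fun s => complex.Im (g s))^`() (lambda X).

Definition cluster_derivative (R : realType) (V : finType) (S : {set {set V}})
    (W : {mset {set V}}) (f : ({set V} -> R) -> R[i]) : R[i] :=
  foldr (fun X g => iter (W X) (pderiv X) g) f (enum S) (fun=> 0).

(* Main.v *)
(* Expand the nested commutators ad_H^m(A) over words X_1 ... X_m in S.  With
   tau(B) = tr(B rho), <A(t)> is the series of
   (it)^m/m! sum_w lambda^w tau(nest w), where nest w = [h_(X_1), [h_(X_2), ..., A]].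
   Averaging the coefficients over the permutations of w gives a function b of
   words, invariant under permutation, with
   <A(t)> = sum_m 1/m! sum_(|w| = m) b(w) lambda^w and |b(w)| <= C K^|w|.
   For series of this shape d/dlambda_X replaces b by b(X :: _), so D_W <A(t)>
   is b at any enumeration of W, and counting the enumerations of each W turns
   the m-th term into the sum of lambda^W/W! D_W <A(t)> over clusters of size m.
   nest w vanishes unless each letter meets a later one or supp A; hence only
   completely connected clusters contribute, and at most m! (deg + 1)^m words do.
   Each word has |tau(nest w)| <= 2^m ||A||, so the m-th term is at most
   (2 (deg + 1) |t|)^m ||A|| <= (|t| / tstar)^m ||A||, and the tail is geometric. *)

Require Import Defs.
From mathcomp Require Import all_boot all_order all_algebra.
From mathcomp Require Import finmap multiset.
From mathcomp Require Import all_classical all_reals all_analysis.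
From mathcomp.real_closed Require Import complex.
From mathcomp Require Import ring lra.

Set Implicit Arguments.
Unset Strict Implicit.
Unset Printing Implicit Defensive.

Import Order.TTheory GRing.Theory Num.Theory numFieldNormedType.Exports.
Import Normc.

Local Open Scope ring_scope.
Local Open Scope complex_scope.
Local Open Scope classical_set_scope.

(** * Complex limits *)

Section ComplexLimits.
Context (R : realType).
Implicit Types (z : R[i]) (u v : nat -> R[i]).

Lemma normc_ge0 z : 0 <= normc z.
Proof. by case: z => a b; apply: sqrtr_ge0. Qed.

Lemma norm_Re_le z : `|complex.Re z| <= normc z.
Proof.
by case: z => a b; rewrite /= -sqrtr_sqr ler_wsqrtr// lerDl sqr_ge0.
Qed.

Lemma norm_Im_le z : `|complex.Im z| <= normc z.
Proof.
by case: z => a b; rewrite /= -sqrtr_sqr ler_wsqrtr// lerDr sqr_ge0.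
Qed.

Lemma normcC (a : R) : normc a%:C = `|a|.
Proof. by rewrite /= expr0n addr0 sqrtr_sqr. Qed.

Lemma normcCi (a : R) : normc (0 +i* a) = `|a|.
Proof. by rewrite /= expr0n add0r sqrtr_sqr. Qed.

Lemma normcX z n : normc (z ^+ n) = normc z ^+ n.
Proof. by elim: n => [|n IH]; rewrite ?expr0 ?normc1// !exprS normcM IH. Qed.

Lemma normc_le_ReIm z : normc z <= `|complex.Re z| + `|complex.Im z|.
Proof.
have -> : z = (complex.Re z)%:C + (0 +i* complex.Im z).
  by case: z => a b; simpc.
apply: le_trans (le_normcD _ _) _; rewrite normcC normcCi.
by case: z => a b /=; rewrite addr0 add0r.
Qed.

Lemma normc_sum (I : Type) (r : seq I) (P : pred I) (F : I -> R[i]) :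
  normc (\sum_(i <- r | P i) F i) <= \sum_(i <- r | P i) normc (F i).
Proof.
elim/big_rec2: _ => [|i x y _ le]; first by rewrite normc0.
by apply: le_trans (le_normcD _ _) _; rewrite lerD2l.
Qed.

Lemma normc_distC z z' : normc (z - z') = normc (z' - z).
Proof. by rewrite -normcN opprB. Qed.

Lemma normc_nat n : normc (n%:R : R[i]) = n%:R.
Proof.
have -> : n%:R = (n%:R)%:C :> R[i] by rewrite rmorph_nat.
by rewrite normcC normr_nat.
Qed.

Lemma ReD z z' : complex.Re (z + z') = complex.Re z + complex.Re z'.
Proof. by case: z z' => [a b] [c e]. Qed.

Lemma ImD z z' : complex.Im (z + z') = complex.Im z + complex.Im z'.
Proof. by case: z z' => [a b] [c e]. Qed.

Lemma ReB z z' : complex.Re (z - z') = complex.Re z - complex.Re z'.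
Proof. by case: z z' => [a b] [c e]. Qed.

Lemma ImB z z' : complex.Im (z - z') = complex.Im z - complex.Im z'.
Proof. by case: z z' => [a b] [c e]. Qed.

Lemma Re_sum (I : Type) (r : seq I) (P : pred I) (F : I -> R[i]) :
  complex.Re (\sum_(i <- r | P i) F i) = \sum_(i <- r | P i) complex.Re (F i).
Proof. exact: (big_morph _ ReD erefl). Qed.

Lemma Im_sum (I : Type) (r : seq I) (P : pred I) (F : I -> R[i]) :
  complex.Im (\sum_(i <- r | P i) F i) = \sum_(i <- r | P i) complex.Im (F i).
Proof. exact: (big_morph _ ImD erefl). Qed.

(** Componentwise convergence, so that limit theorems for real sequences apply directly. *)
Definition cvgc u z : Prop :=
  (fun n => complex.Re (u n)) @ \oo --> complex.Re z /\
  (fun n => complex.Im (u n)) @ \oo --> complex.Im z.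

Lemma cvgc_cst z : cvgc (fun=> z) z.
Proof. by split; apply: cvg_cst. Qed.

Lemma cvgcD u v z z' : cvgc u z -> cvgc v z' -> cvgc (fun n => u n + v n) (z + z').
Proof.
move=> [ur ui] [vr vi]; split.
- rewrite ReD; under eq_cvg do rewrite ReD; exact: cvgD.
- rewrite ImD; under eq_cvg do rewrite ImD; exact: cvgD.
Qed.

Lemma cvgcM u v z z' : cvgc u z -> cvgc v z' -> cvgc (fun n => u n * v n) (z * z').
Proof.
move=> [ur ui] [vr vi].
have ReM (x y : R[i]) : complex.Re (x * y) =
  complex.Re x * complex.Re y - complex.Im x * complex.Im y.
  by case: x y => [a b] [c e].
have ImM (x y : R[i]) : complex.Im (x * y) =
  complex.Re x * complex.Im y + complex.Im x * complex.Re y.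
  by case: x y => [a b] [c e].
split.
- rewrite ReM; under eq_cvg do rewrite ReM.
  by apply: cvgB; apply: cvgM.
- rewrite ImM; under eq_cvg do rewrite ImM.
  by apply: cvgD; apply: cvgM.
Qed.

Lemma cvgc_sum (I : Type) (r : seq I) (P : pred I) (F : I -> nat -> R[i])
    (G : I -> R[i]) :
  (forall i, cvgc (F i) (G i)) ->
  cvgc (fun n => \sum_(i <- r | P i) F i n) (\sum_(i <- r | P i) G i).
Proof.
move=> FG; elim: r => [|i r IH].
  under eq_fun do rewrite big_nil; rewrite big_nil; exact: cvgc_cst.
rewrite big_cons; under eq_fun do rewrite big_cons.
by case: ifP => // _; apply: cvgcD.
Qed.

Lemma cvgc_dist u z : cvgc u z <-> (fun n => normc (u n - z)) @ \oo --> 0.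
Proof.
have dist0 (w : nat -> R) l : w @ \oo --> l -> (fun n => `|w n - l|) @ \oo --> 0.
  move=> wl; rewrite -(normr0 R) -(subrr l); apply: cvg_norm.
  by apply: cvgB => //; exact: cvg_cst.
split=> [[ur ui]|uz].
  apply: (@squeeze_cvgr _ _ _ _ (fun=> 0)
    (fun n => `|complex.Re (u n) - complex.Re z|
              + `|complex.Im (u n) - complex.Im z|)).
  - by apply: nearW => n; rewrite normc_ge0 -ReB -ImB normc_le_ReIm.
  - exact: cvg_cst.
  - by rewrite -[X in _ --> X](addr0 0); apply: cvgD; apply: dist0.
split; apply/cvgrPdist_le => e e0; near=> n.
  rewrite -ReB; apply: le_trans (norm_Re_le _) _; rewrite normc_distC.
  by near: n; apply: (cvgr_le _ uz).
rewrite -ImB; apply: le_trans (norm_Im_le _) _; rewrite normc_distC.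
by near: n; apply: (cvgr_le _ uz).
Unshelve. all: by end_near. Qed.

(** Links [cvgc] to the [limn] in the definition of [expmx]: the moduli of the differences tend to
    0, and limits in [R[i]] are unique. *)
Lemma cvgc_limn u z : cvgc u z -> limn (u : nat -> R[i]^o) = z :> R[i].
Proof.
move=> /cvgc_dist uz.
suff uz' : (u : nat -> R[i]^o) @ \oo --> (z : R[i]^o).
  exact: (cvg_lim (@norm_hausdorff _ R[i]^o) uz').
apply/cvgrPdist_le => /= -[e e'] e0.
(* A positive element of [R[i]] is real, so the radius reduces to the real number [e]. *)
have [e'0 e_gt0] : e' = 0 /\ 0 < e.
  by move: e0; rewrite ltcE /= => /andP[/eqP -> ->].
near=> n; rewrite e'0.
suff : normc (z - u n) <= e by rewrite -lecR.
rewrite normc_distC; near: n; exact: (cvgr_le _ uz).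
Unshelve. all: by end_near. Qed.

(** From rank [N] on, [normc (z - z') <= normc (u n - z) + b], and the right side tends to [b]. *)
Lemma cvgc_le u z z' (b : R) N :
  cvgc u z -> (forall n, (N <= n)%N -> normc (u n - z') <= b) ->
  normc (z - z') <= b.
Proof.
move=> /cvgc_dist uz ub.
have : (fun n => normc (u n - z) + b) @ \oo --> 0 + b.
  by apply: cvgD uz _; apply: cvg_cst.
rewrite add0r => cv; apply: (cvgr_to_ge cv); near=> n.
have -> : z - z' = (z - u n) + (u n - z') by rewrite addrA subrK.
apply: le_trans (le_normcD _ _) _; rewrite normc_distC lerD2l; apply: ub.
by near: n; exists N.
Unshelve. all: by end_near. Qed.

(** Comparison of the real and imaginary parts with the exponential series at [x], scaled by [C]. *)
Lemma cvgc_series_exp (a : nat -> R[i]) (C x : R) :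
  (forall m, normc (a m) <= C * (x ^+ m / m`!%:R)) ->
  exists z, cvgc (fun n => \sum_(m < n) a m) z.
Proof.
move=> aC.
have C0 m : 0 <= C * (x ^+ m / m`!%:R) by apply: le_trans (aC m); exact: normc_ge0.
have dom : cvgn (series (fun m => C * (x ^+ m / m`!%:R))).
  have -> : (fun m => C * (x ^+ m / m`!%:R)) = C *: exp_coeff x by [].
  by apply: is_cvg_seriesZ; apply: is_cvg_series_exp_coeff.
have cv (f : nat -> R) : (forall m, `|f m| <= C * (x ^+ m / m`!%:R)) ->
    cvgn (series f).
  move=> fC; apply: normed_cvg; apply: series_le_cvg dom => //= m.
have /cvg_ex[zr zrP] := cv (fun m => complex.Re (a m))
  (fun m => le_trans (norm_Re_le _) (aC m)).
have /cvg_ex[zi ziP] := cv (fun m => complex.Im (a m))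
  (fun m => le_trans (norm_Im_le _) (aC m)).
exists (zr +i* zi); split => /=.
- under eq_cvg do rewrite Re_sum -(big_mkord xpredT (fun m => complex.Re (a m))).
  exact: zrP.
- under eq_cvg do rewrite Im_sum -(big_mkord xpredT (fun m => complex.Im (a m))).
  exact: ziP.
Qed.

Lemma exp_partial_sum_le (x : R) n :
  0 <= x -> \sum_(m < n) x ^+ m / m`!%:R <= expR x.
Proof.
move=> x0; rewrite -(big_mkord xpredT (exp_coeff x)).
apply: nondecreasing_cvgn_le (is_cvg_series_exp_coeff x) n.
apply: nondecreasing_series => m _ _.
by rewrite /exp_coeff /= divr_ge0 ?exprn_ge0.
Qed.

Lemma exp_partial_sum_cvg (x : R) :
  (fun n => \sum_(m < n) x ^+ m / m`!%:R) @ \oo --> expR x.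
Proof.
under eq_cvg do rewrite -(big_mkord xpredT (exp_coeff x)).
exact: is_cvg_series_exp_coeff.
Qed.

End ComplexLimits.

(** * The operator norm and the trace bound *)

Section OperatorNorm.
Local Open Scope sesquilinear_scope.
Context (R : realType).
Implicit Types (N : nat).

(** Lagrange's identity: twice the gap between the two sides is the double sum of the squares of
    [a i * b j - a j * b i]. *)
Lemma cauchy_schwarz (I : finType) (a b : I -> R) :
  (\sum_i a i * b i) ^+ 2 <= (\sum_i a i ^+ 2) * (\sum_i b i ^+ 2).
Proof.
rewrite -subr_ge0 -(@pmulr_rge0 _ 2)// mulrBr.
have -> : 2 * ((\sum_i a i ^+ 2) * (\sum_i b i ^+ 2))
    - 2 * (\sum_i a i * b i) ^+ 2 =
    \sum_i \sum_j (a i * b j - a j * b i) ^+ 2.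
  have -> : \sum_i \sum_j (a i * b j - a j * b i) ^+ 2 =
      \sum_i \sum_j (a i ^+ 2 * b j ^+ 2) + \sum_i \sum_j (a j ^+ 2 * b i ^+ 2)
      - 2 * \sum_i \sum_j ((a i * b i) * (a j * b j)).
    rewrite -big_split/= mulr_sumr -sumrB; apply: eq_bigr => i _.
    rewrite -big_split/= mulr_sumr -sumrB; apply: eq_bigr => j _.
    by ring.
  rewrite [X in _ + X - _]exchange_big/= expr2 !mulr_suml.
  under [X in _ = X + _ - _]eq_bigr do rewrite -mulr_sumr.
  under [X in _ = _ + X - _]eq_bigr do rewrite -mulr_sumr.
  under [X in _ = _ + _ - 2 * X]eq_bigr do rewrite -mulr_sumr.
  by ring.
by apply: sumr_ge0 => i _; apply: sumr_ge0 => j _; apply: sqr_ge0.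
Qed.

Lemma normc_normr (z : R[i]) : (normc z)%:C = `|z|.
Proof. by []. Qed.

Lemma vnorm_ge0 N (v : 'cV[R[i]]_N) : 0 <= vnorm v.
Proof. exact: sqrtr_ge0. Qed.

Lemma vnorm_sqr N (v : 'cV[R[i]]_N) :
  vnorm v ^+ 2 = \sum_i normc (v i ord0) ^+ 2.
Proof. by rewrite sqr_sqrtr// sumr_ge0// => i _; apply: sqr_ge0. Qed.

Lemma vnorm0 N : vnorm (0 : 'cV[R[i]]_N) = 0.
Proof.
apply/eqP; rewrite -sqrf_eq0 vnorm_sqr big1// => i _.
by rewrite mxE normc0 expr0n.
Qed.

Lemma vnorm_eq0 N (v : 'cV[R[i]]_N) : vnorm v = 0 -> v = 0.
Proof.
move=> v0; apply/matrixP => i j; rewrite ord1 mxE.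
have /eqP := vnorm_sqr v; rewrite v0 expr0n eq_sym psumr_eq0; last first.
  by move=> k _; apply: sqr_ge0.
move=> /allP /(_ i (mem_index_enum i)) /=; rewrite sqrf_eq0 => /eqP.
exact: eq0_normc.
Qed.

Lemma sum_normc_le N (u v : 'cV[R[i]]_N) :
  \sum_i normc (u i ord0) * normc (v i ord0) <= vnorm u * vnorm v.
Proof.
rewrite -(@ler_pXn2r _ 2)// ?nnegrE ?mulr_ge0 ?vnorm_ge0//; last first.
  by apply: sumr_ge0 => i _; rewrite mulr_ge0 ?normc_ge0.
by rewrite exprMn !vnorm_sqr; apply: cauchy_schwarz.
Qed.

Lemma vnormD N (u v : 'cV[R[i]]_N) : vnorm (u + v) <= vnorm u + vnorm v.
Proof.
rewrite -(@ler_pXn2r _ 2)// ?nnegrE ?addr_ge0 ?vnorm_ge0//.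
rewrite sqrrD !vnorm_sqr.
apply: (@le_trans _ _ (\sum_i (normc (u i ord0) + normc (v i ord0)) ^+ 2)).
  apply: ler_sum => i _; rewrite mxE.
  by rewrite ler_pXn2r ?nnegrE ?addr_ge0 ?normc_ge0// le_normcD.
under eq_bigr do rewrite sqrrD.
rewrite !big_split/= lerD2r lerD2l mulr2n.
by apply: lerD; apply: sum_normc_le.
Qed.

Lemma vnormZ N (a : R[i]) (v : 'cV[R[i]]_N) : vnorm (a *: v) = normc a * vnorm v.
Proof.
apply/eqP; rewrite -(@eqrXn2 _ 2) ?mulr_ge0 ?vnorm_ge0 ?normc_ge0//.
rewrite exprMn !vnorm_sqr mulr_sumr; apply/eqP/eq_bigr => i _.
by rewrite mxE normcM exprMn.
Qed.

Lemma normc_le_vnorm N (v : 'cV[R[i]]_N) i : normc (v i ord0) <= vnorm v.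
Proof.
rewrite -(@ler_pXn2r _ 2) ?nnegrE ?vnorm_ge0 ?normc_ge0// vnorm_sqr.
by rewrite (bigD1 i)//= lerDl sumr_ge0// => j _; apply: sqr_ge0.
Qed.

Lemma vnorm_le_sum N (v : 'cV[R[i]]_N) : vnorm v <= \sum_i normc (v i ord0).
Proof.
have s0 : 0 <= \sum_i normc (v i ord0) by apply: sumr_ge0 => i _; apply: normc_ge0.
rewrite -(@ler_pXn2r _ 2) ?nnegrE ?vnorm_ge0// vnorm_sqr [leRHS]expr2 mulr_sumr.
apply: ler_sum => i _; rewrite expr2 ler_wpM2r ?normc_ge0//.
by rewrite (bigD1 i)//= lerDl sumr_ge0// => j _; apply: normc_ge0.
Qed.

(** A crude bound whose purpose is to make the set in [opnorm] bounded, so that its supremum is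
    genuine. *)
Lemma vnorm_mulmx_entries N (B : 'M[R[i]]_N) (v : 'cV[R[i]]_N) :
  vnorm (B *m v) <= (\sum_i \sum_j normc (B i j)) * vnorm v.
Proof.
apply: le_trans (vnorm_le_sum _) _; rewrite mulr_suml; apply: ler_sum => i _.
rewrite mxE; apply: le_trans (normc_sum _ _ _) _; rewrite mulr_suml.
by apply: ler_sum => j _; rewrite normcM ler_wpM2l ?normc_ge0 ?normc_le_vnorm.
Qed.

Lemma opnorm_has_sup N (B : 'M[R[i]]_N) :
  has_sup [set vnorm (B *m v) | v in [set v : 'cV[R[i]]_N | vnorm v <= 1]].
Proof.
split; first by exists (vnorm (B *m 0)), 0; rewrite //= vnorm0.
exists (\sum_i \sum_j normc (B i j)) => _ /= [v v1 <-].
apply: le_trans (vnorm_mulmx_entries _ _) _; rewrite ler_piMr//.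
by do 2 (apply: sumr_ge0 => ? _); apply: normc_ge0.
Qed.

Lemma opnorm_ge0 N (B : 'M[R[i]]_N) : 0 <= opnorm B.
Proof.
apply: ub_le_sup; first exact: (opnorm_has_sup B).2.
by exists 0; rewrite ?mulmx0 /= vnorm0.
Qed.

(** Rescale [v] to norm 1 and compare with the supremum; the zero vector cannot be rescaled and is
    treated apart. *)
Lemma vnorm_mulmx N (B : 'M[R[i]]_N) (v : 'cV[R[i]]_N) :
  vnorm (B *m v) <= opnorm B * vnorm v.
Proof.
have [v0|v0] := eqVneq (vnorm v) 0.
  by rewrite (vnorm_eq0 v0) mulmx0 vnorm0 mulr0.
have vp : 0 < vnorm v by rewrite lt_def v0 vnorm_ge0.
rewrite -ler_pdivrMr// mulrC.
have cE : normc (vnorm v)^-1%:C = (vnorm v)^-1.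
  by rewrite normcC ger0_norm// invr_ge0 ltW.
rewrite -{1}cE -vnormZ scalemxAr.
apply: ub_le_sup; first exact: (opnorm_has_sup B).2.
by exists ((vnorm v)^-1%:C *: v) => //=; rewrite vnormZ cE mulVf.
Qed.

Lemma opnorm_le N (B : 'M[R[i]]_N) (c : R) :
  0 <= c -> (forall v, vnorm (B *m v) <= c * vnorm v) -> opnorm B <= c.
Proof.
move=> c0 Bc; apply: sup_le_ub; first exact: (opnorm_has_sup B).1.
move=> _ /= [v v1 <-]; apply: le_trans (Bc v) _.
by rewrite ler_piMr.
Qed.

Lemma opnormD N (B B' : 'M[R[i]]_N) : opnorm (B + B') <= opnorm B + opnorm B'.
Proof.
apply: opnorm_le => [|v]; first by rewrite addr_ge0 ?opnorm_ge0.
rewrite mulmxDl mulrDl; apply: le_trans (vnormD _ _) _.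
by apply: lerD; apply: vnorm_mulmx.
Qed.

Lemma opnormM N (B B' : 'M[R[i]]_N) : opnorm (B *m B') <= opnorm B * opnorm B'.
Proof.
apply: opnorm_le => [|v]; first by rewrite mulr_ge0 ?opnorm_ge0.
rewrite -mulmxA -mulrA; apply: le_trans (vnorm_mulmx _ _) _.
by rewrite ler_wpM2l ?opnorm_ge0// vnorm_mulmx.
Qed.

Lemma opnormZ N (a : R[i]) (B : 'M[R[i]]_N) : opnorm (a *: B) <= normc a * opnorm B.
Proof.
apply: opnorm_le => [|v]; first by rewrite mulr_ge0 ?opnorm_ge0 ?normc_ge0.
by rewrite -scalemxAl vnormZ -mulrA ler_wpM2l ?normc_ge0// vnorm_mulmx.
Qed.

Lemma opnorm0 N : opnorm (0 : 'M[R[i]]_N) = 0.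
Proof.
apply/eqP; rewrite eq_le opnorm_ge0 andbT; apply: opnorm_le => // v.
by rewrite mul0mx vnorm0 mul0r.
Qed.

Lemma opnormN N (B : 'M[R[i]]_N) : opnorm (- B) <= opnorm B.
Proof.
by rewrite -scaleN1r (le_trans (opnormZ _ _))// normcN normc1 mul1r.
Qed.

Lemma opnorm_sum N (I : Type) (r : seq I) (P : pred I) (F : I -> 'M[R[i]]_N) :
  opnorm (\sum_(i <- r | P i) F i) <= \sum_(i <- r | P i) opnorm (F i).
Proof.
elim/big_rec2: _ => [|i x y _ le]; first by rewrite opnorm0.
by apply: le_trans (opnormD _ _) _; rewrite lerD2l.
Qed.

Lemma opnorm_expr N (B : 'M[R[i]]_N) n : opnorm (B ^+ n) <= opnorm B ^+ n.
Proof.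
elim: n => [|n IH].
  by rewrite !expr0; apply: opnorm_le => // v; rewrite mul1mx mul1r.
rewrite !exprS; apply: le_trans (opnormM _ _) _.
by rewrite ler_wpM2l ?opnorm_ge0.
Qed.

Lemma opnorm_commutator N (B B' : 'M[R[i]]_N) :
  opnorm (B *m B' - B' *m B) <= 2 * opnorm B * opnorm B'.
Proof.
apply: le_trans (opnormD _ _) _.
have -> : 2 * opnorm B * opnorm B' = opnorm B * opnorm B' + opnorm B' * opnorm B.
  by ring.
by apply: lerD; [|apply: le_trans (opnormN _) _]; apply: opnormM.
Qed.

Lemma normc_entry_le N (B : 'M[R[i]]_N) i j : normc (B i j) <= opnorm B.
Proof.
have v1 : vnorm (delta_mx j 0 : 'cV[R[i]]_N) <= 1.
  apply: le_trans (vnorm_le_sum _) _; rewrite (bigD1 j)//= big1 ?mxE ?eqxx ?addr0.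
    by rewrite normc1.
  by move=> k kj; rewrite mxE (negbTE kj) normc0.
have -> : B i j = col j B i ord0 by rewrite mxE.
rewrite colE.
apply: le_trans (normc_le_vnorm _ _) _; apply: le_trans (vnorm_mulmx _ _) _.
by rewrite ler_piMr ?opnorm_ge0.
Qed.

(** Cauchy-Schwarz for the vectors [u] and [B *m u]. *)
Lemma normc_tr_diag N (B : 'M[R[i]]_N) (u : 'cV[R[i]]_N) :
  vnorm u <= 1 -> normc ((u^t* *m B *m u) ord0 ord0) <= opnorm B.
Proof.
move=> u1; rewrite -mulmxA mxE; apply: le_trans (normc_sum _ _ _) _.
under eq_bigr => i _.
  rewrite normcM.
  have -> : normc ((u^t* : 'rV_N) ord0 i) = normc (u i ord0).
    by rewrite !mxE; apply: complexI; rewrite !normc_normr norm_conjC.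
  over.
apply: le_trans (sum_normc_le _ _) _.
apply: (@le_trans _ _ (1 * opnorm B)); last by rewrite mul1r.
apply: ler_pM; rewrite ?vnorm_ge0//; apply: le_trans (vnorm_mulmx _ _) _.
by rewrite ler_piMr ?opnorm_ge0.
Qed.

(* In a spectral basis of [rho] the trace is an average of diagonal entries of
   [B], weighted by the eigenvalues of [rho]. *)
Lemma normc_tr_state N (B rho : 'M[R[i]]_N) :
  is_state rho -> normc (\tr (B *m rho)) <= opnorm B.
Proof.
move=> [rho_herm rho_psd rho_tr].
have /hermitian_normalmx/orthomx_spectralP := rho_herm.
have := spectral_unitarymx rho.
move: (spectralmx rho) (spectral_diag rho) => P D PU rhoE.
have PV := invmx_unitary PU.
rewrite PV in rhoE.
pose u k : 'cV[R[i]]_N := col k (P^t*).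
have PP : P *m P^t* = 1%:M by apply/unitarymxP.
have uE k : u k ^t* = row k P.
  by apply/matrixP => i j; rewrite !mxE conjCK.
have uBu k (C : 'M[R[i]]_N) : (P *m C *m P^t*) k k = (u k ^t* *m C *m u k) ord0 ord0.
  rewrite uE -row_mul [LHS]mxE [RHS]mxE.
  by apply: eq_bigr => j _; rewrite !mxE.
have u1 k : vnorm (u k) <= 1.
  have : (P *m 1%:M *m P^t*) k k = 1 by rewrite mulmx1 PP mxE eqxx.
  rewrite uBu mulmx1 mxE => uk.
  rewrite -(@ler_pXn2r _ 2) ?nnegrE ?vnorm_ge0// vnorm_sqr expr1n.
  rewrite -lecR rmorph_sum rmorph1 -uk le_eqVlt; apply/orP; left; apply/eqP.
  apply: eq_bigr => i _; rewrite rmorphXn/= normc_normr normCK mulrC.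
  by congr (_ * _); rewrite !mxE.
(* Positivity of [rho] makes each eigenvalue [D 0 k] nonnegative; unit trace then makes the weights
   sum to 1 in [sD]. *)
have DE k : D 0 k = (u k ^t* *m rho *m u k) ord0 ord0.
  rewrite -uBu rhoE -!mulmxA PP mulmx1 mulmxA PP mul1mx mxE eqxx mulr1n//.
have D0 k : 0 <= D 0 k by rewrite DE; apply: rho_psd.
have trE : \tr (B *m rho) = \sum_k (u k ^t* *m B *m u k) ord0 ord0 * D 0 k.
  rewrite rhoE 2!mulmxA mxtrace_mulC 2!mulmxA /mxtrace.
  apply: eq_bigr => k _; rewrite mul_mx_diag mxE uBu//.
have sD : \sum_k normc (D 0 k) = 1.
  apply: complexI; rewrite rmorph_sum rmorph1 /=.
  transitivity (\sum_k D 0 k).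
    by apply: eq_bigr => k _; rewrite normc_normr ger0_norm.
  rewrite -[RHS]rho_tr rhoE mxtrace_mulC mulmxA PP mul1mx.
  by rewrite mxtrace_diag.
rewrite trE; apply: le_trans (normc_sum _ _ _) _.
rewrite -[leRHS]mulr1 -sD mulr_sumr; apply: ler_sum => k _.
by rewrite normcM ler_wpM2r ?normc_ge0 ?normc_tr_diag.
Qed.

End OperatorNorm.

(** * Conjugation by a matrix exponential as a series of nested commutators *)

Lemma sum_triangle (V : nmodType) (f : nat -> nat -> V) (K : nat) :
  \sum_(0 <= p < K) \sum_(0 <= q < K - p) f p q =
  \sum_(0 <= m < K) \sum_(0 <= p < m.+1) f p (m - p)%N.
Proof.
elim: K => [|K IH]; first by rewrite !big_geq.
rewrite [RHS]big_nat_recr//= -IH big_nat_recr//= subSnn big_nat1.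
have -> : \sum_(0 <= p < K) \sum_(0 <= q < K.+1 - p) f p q =
    \sum_(0 <= p < K) \sum_(0 <= q < K - p) f p q
    + \sum_(0 <= p < K) f p (K - p)%N.
  rewrite -big_split/= big_nat [RHS]big_nat; apply: eq_bigr => p /andP[_ pK].
  by rewrite subSn ?(ltnW pK)// big_nat_recr.
by rewrite -addrA; congr (_ + _); rewrite [RHS]big_nat_recr//= subnn.
Qed.

(** Bookkeeping for the Cauchy product: the square of indices is the triangle [p + q < K], read
    along antidiagonals, plus the corner [K <= p + q]. *)
Lemma sum_square (V : nmodType) (f : nat -> nat -> V) (K : nat) :
  \sum_(p < K) \sum_(q < K) f p q =
  \sum_(m < K) \sum_(p < m.+1) f p (m - p)%N +
  \sum_(p < K) \sum_(q < K | (K <= p + q)%N) f p q.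
Proof.
transitivity (\sum_(0 <= p < K) \sum_(0 <= q < K - p) f p q
   + \sum_(p < K) \sum_(q < K | (K <= p + q)%N) f p q); last first.
  congr (_ + _); rewrite sum_triangle big_mkord; apply: eq_bigr => m _.
  by rewrite big_mkord.
rewrite big_mkord -big_split/=; apply: eq_bigr => p _.
rewrite (bigID (fun q : 'I_K => (K <= p + q)%N))/= addrC; congr (_ + _).
rewrite (big_nat_widen _ _ K) ?leq_subr// big_mkord.
by apply: eq_bigl => q; rewrite -ltnNge ltn_subRL.
Qed.

Section ExponentialConjugation.
Context (R : realType) (N : nat).
Implicit Types (X A B : 'M[R[i]]_N).

Definition ad X B := X *m B - B *m X.

(** The [(p, q)] term of the double series for [exp(X) A exp(-X)]. *)
Let term X A (p q : nat) : 'M[R[i]]_N :=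
  (p`!%:R^-1 * q`!%:R^-1 : R[i]) *: (X ^+ p *m A *m (- X) ^+ q).

Lemma factS_inv (m : nat) :
  m`!%:R^-1 = m.+1%:R * (m.+1`!%:R)^-1 :> R[i].
Proof.
by rewrite factS natrM invfM mulrA mulfV ?mul1r//.
Qed.

(** Binomial theorem for [ad X], the difference of the commuting left and right multiplications by
    [X]. In the induction the left one brings the weight [i] and the right one [m.+1 - i], which add
    up to [m.+1]. *)
Lemma ad_iter_binomial X A m :
  m`!%:R^-1 *: iter m (ad X) A = \sum_(p < m.+1) term X A p (m - p)%N.
Proof.
elim: m => [|m IH].
  by rewrite big_ord1 /term /= !expr0 mul1mx mulmx1 fact0 invr1 mulr1 !scale1r.
have mN0 : m.+1%:R != 0 :> R[i] by rewrite pnatr_eq0.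
apply: (scalerI mN0); rewrite scalerA -factS_inv iterS {1}/ad scalerBr.
rewrite scalemxAr scalemxAl IH mulmx_sumr mulmx_suml -sumrN scaler_sumr.
have -> : \sum_(i < m.+1) X *m term X A i (m - i) =
    \sum_(i < m.+2) (i%:R : R[i]) *: term X A i (m.+1 - i).
  rewrite [RHS]big_ord_recl/= scale0r add0r; apply: eq_bigr => i _.
  rewrite /bump/= add1n subSS /term -scalemxAr !mulmxA.
  rewrite -[X *m X ^+ i]/(X * X ^+ i) -exprS scalerA.
  by rewrite mulrA -factS_inv.
have -> : \sum_(i < m.+1) - (term X A i (m - i) *m X) =
    \sum_(i < m.+2) ((m.+1 - i)%N%:R : R[i]) *: term X A i (m.+1 - i).
  rewrite [RHS]big_ord_recr/= subnn scale0r addr0; apply: eq_bigr => i _.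
  have im : (i <= m)%N by rewrite -ltnS.
  rewrite subSn// /term -scalemxAl -scalerN -mulmxN -[_ *m - X]mulmxA.
  rewrite -[(- X) ^+ _ *m - X]/((- X) ^+ _ * - X) -exprSr.
  by rewrite scalerA mulrCA -factS_inv.
rewrite -big_split/=; apply: eq_bigr => i _.
by rewrite -scalerDl -natrD subnKC// -ltnS.
Qed.

Definition cvgmx (U : nat -> 'M[R[i]]_N) (L : 'M[R[i]]_N) :=
  forall i j, cvgc (fun n => U n i j) (L i j).

Lemma cvgmxM U U' L L' :
  cvgmx U L -> cvgmx U' L' -> cvgmx (fun n => U n *m U' n) (L *m L').
Proof.
move=> UL UL' i j; rewrite mxE; under eq_fun do rewrite mxE.
by apply: cvgc_sum => k; apply: cvgcM.
Qed.

Lemma cvgmx_cst L : cvgmx (fun=> L) L.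
Proof. by move=> i j; apply: cvgc_cst. Qed.

Lemma cvgmx_tr U L : cvgmx U L -> cvgc (fun n => \tr (U n)) (\tr L).
Proof. by move=> UL; apply: cvgc_sum. Qed.

Lemma opnorm_exp_term X p (a : R[i]) :
  opnorm (a *: X ^+ p) <= normc a * opnorm X ^+ p.
Proof.
apply: le_trans (opnormZ _ _) _.
by rewrite ler_wpM2l ?normc_ge0 ?opnorm_expr.
Qed.

Lemma normc_invfact p : normc (p`!%:R^-1 : R[i]) = p`!%:R^-1.
Proof. by rewrite normcV normc_nat. Qed.

(** The [limn] in [expmx] is meaningful only for a convergent sequence; domination of the entries by
    [opnorm X ^+ p / p!] supplies the convergence. *)
Lemma cvgmx_expmx X :
  cvgmx (fun K => \sum_(p < K) (p`!%:R)^-1 *: X ^+ p) (expmx X).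
Proof.
move=> i j; rewrite /expmx mxE.
have [z zP] : exists z, cvgc (fun K => \sum_(p < K)
    ((p`!%:R)^-1 *: X ^+ p : 'M[R[i]]_N) i j) z.
  apply: (@cvgc_series_exp _ (fun p => ((p`!%:R)^-1 *: X ^+ p : 'M[R[i]]_N) i j)
    1 (opnorm X)) => p; rewrite mul1r mulrC.
  apply: le_trans (normc_entry_le _ _ _) _.
  by rewrite -normc_invfact; exact: opnorm_exp_term.
have zP' : cvgc (fun K => (\sum_(p < K) (p`!%:R)^-1 *: X ^+ p : 'M[R[i]]_N) i j) z.
  by under eq_fun do rewrite summxE.
by rewrite (cvgc_limn zP').
Qed.

Lemma opnorm_term X A p q :
  opnorm (term X A p q) <=
  opnorm A * (opnorm X ^+ p / p`!%:R * (opnorm X ^+ q / q`!%:R)).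
Proof.
apply: le_trans (opnormZ _ _) _; rewrite normcM !normc_invfact.
have -> : opnorm A * (opnorm X ^+ p / p`!%:R * (opnorm X ^+ q / q`!%:R)) =
  p`!%:R^-1 * q`!%:R^-1 * (opnorm X ^+ p * opnorm A * opnorm X ^+ q).
  by ring.
apply: ler_wpM2l; first by rewrite mulr_ge0 ?invr_ge0.
apply: le_trans (opnormM _ _) _; apply: ler_pM; rewrite ?opnorm_ge0//.
  apply: le_trans (opnormM _ _) _.
  by rewrite ler_wpM2r ?opnorm_ge0 ?opnorm_expr.
apply: le_trans (opnorm_expr _ _) _.
by rewrite lerXn2r ?nnegrE ?opnorm_ge0 ?opnormN.
Qed.

Lemma exp_coeff_conv (x : R) m :
  \sum_(p < m.+1) (x ^+ p / p`!%:R * (x ^+ (m - p) / (m - p)`!%:R)) =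
  (x + x) ^+ m / m`!%:R.
Proof.
rewrite exprDn mulr_suml; apply: eq_bigr => p _.
have pm : (p <= m)%N by rewrite -ltnS.
rewrite -mulr_natr -(bin_fact pm) !natrM.
have := fact_gt0 p; rewrite -(ltr0n R) => /lt0r_neq0 p0.
have := fact_gt0 (m - p); rewrite -(ltr0n R) => /lt0r_neq0 mp0.
have := bin_gt0 m p; rewrite pm -(ltr0n R) => /lt0r_neq0 b0.
by field; rewrite p0 mp0 b0.
Qed.

(* The difference of the square and the triangle of the Cauchy product is
   dominated by the same difference for real exponential series. *)
Lemma opnorm_square_sub_triangle X A K :
  opnorm ((\sum_(p < K) p`!%:R^-1 *: X ^+ p) *m A
            *m (\sum_(p < K) p`!%:R^-1 *: (- X) ^+ p)
          - \sum_(m < K) m`!%:R^-1 *: iter m (ad X) A) <=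
  opnorm A * ((\sum_(p < K) opnorm X ^+ p / p`!%:R) ^+ 2
             - \sum_(m < K) (opnorm X + opnorm X) ^+ m / m`!%:R).
Proof.
set x := opnorm X; pose g p q := opnorm A * (x ^+ p / p`!%:R * (x ^+ q / q`!%:R)).
have -> : (\sum_(p < K) p`!%:R^-1 *: X ^+ p) *m A
    *m (\sum_(p < K) p`!%:R^-1 *: (- X) ^+ p) =
    \sum_(p < K) \sum_(q < K) term X A p q.
  rewrite !mulmx_suml; apply: eq_bigr => p _.
  rewrite mulmx_sumr; apply: eq_bigr => q _.
  by rewrite /term -!scalemxAl -scalemxAr scalerA.
under [X in _ - X]eq_bigr do rewrite ad_iter_binomial.
(* The triangle of the matrix product is exactly the commutator sum, so only the corner [K <= p + q]
   is left to bound. *)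
rewrite sum_square addrC addKr.
have -> : opnorm A * ((\sum_(p < K) x ^+ p / p`!%:R) ^+ 2
    - \sum_(m < K) (x + x) ^+ m / m`!%:R) =
    \sum_(p < K) \sum_(q < K | (K <= p + q)%N) g p q.
  apply/eqP; rewrite mulrBr subr_eq addrC; apply/eqP.
  transitivity (\sum_(p < K) \sum_(q < K) g p q).
    rewrite expr2 mulr_suml mulr_sumr; apply: eq_bigr => p _.
    by rewrite mulr_sumr mulr_sumr.
  rewrite sum_square; congr (_ + _); rewrite mulr_sumr; apply: eq_bigr => m _.
  by rewrite -exp_coeff_conv mulr_sumr.
apply: le_trans (opnorm_sum _ _ _) _; apply: ler_sum => p _.
apply: le_trans (opnorm_sum _ _ _) _; apply: ler_sum => q _.
exact: opnorm_term.
Qed.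

(** Under the trace against [rho], the product of partial exponentials and the commutator sum differ
    by at most [e K], whose limit is [opnorm A * (exp(x) * exp(x) - exp(x + x)) = 0] with
    [x = opnorm X]. *)
Lemma cvgc_tr_conj X A rho : is_state rho ->
  cvgc (fun K => \sum_(m < K) m`!%:R^-1 * \tr (iter m (ad X) A *m rho))
       (\tr (expmx X *m A *m expmx (- X) *m rho)).
Proof.
move=> st; apply/cvgc_dist.
set l := \tr _.
pose P K : 'M[R[i]]_N := \sum_(p < K) p`!%:R^-1 *: X ^+ p.
pose Q K : 'M[R[i]]_N := \sum_(p < K) p`!%:R^-1 *: (- X) ^+ p.
have /cvgc_dist PQ : cvgc (fun K => \tr (P K *m A *m Q K *m rho)) l.
  apply: cvgmx_tr; apply: cvgmxM (cvgmx_cst _); apply: cvgmxM (cvgmx_expmx _).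
  by apply: cvgmxM (cvgmx_expmx _) (cvgmx_cst _).
pose e K := opnorm A * ((\sum_(p < K) opnorm X ^+ p / p`!%:R) ^+ 2
  - \sum_(m < K) (opnorm X + opnorm X) ^+ m / m`!%:R).
have e0 : e @ \oo --> 0.
  have -> : 0 = opnorm A * (expR (opnorm X) * expR (opnorm X)
                 - expR (opnorm X + opnorm X)) by rewrite expRD subrr mulr0.
  apply: cvgM; first exact: cvg_cst.
  apply: cvgB; last exact: exp_partial_sum_cvg.
  by apply: cvgM; exact: exp_partial_sum_cvg.
apply: (@squeeze_cvgr _ _ _ _ (fun=> 0)
  (fun K => e K + normc (\tr (P K *m A *m Q K *m rho) - l))).
- apply: nearW => K; rewrite normc_ge0/=.
  set s := \sum_(m < K) _.
  have -> : s - l = (s - \tr (P K *m A *m Q K *m rho))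
                    + (\tr (P K *m A *m Q K *m rho) - l) by rewrite addrA subrK.
  apply: le_trans (le_normcD _ _) _; rewrite lerD2r normc_distC.
  have -> : s = \tr ((\sum_(m < K) m`!%:R^-1 *: iter m (ad X) A) *m rho).
    rewrite mulmx_suml raddf_sum; apply: eq_bigr => m _ /=.
    by rewrite -scalemxAl mxtraceZ.
  rewrite -raddfB/= -mulmxBl; apply: le_trans (normc_tr_state _ st) _.
  exact: opnorm_square_sub_triangle.
- exact: cvg_cst.
- by rewrite -[X in _ --> X](addr0 0); apply: cvgD.
Qed.

End ExponentialConjugation.

(** * Power series indexed by words *)

(** A quadratic remainder keeps the difference quotient within [D * |h|] of [l]. *)
Lemma derive1_quadratic (R : realType) (g : R -> R) (a l D : R) :
  (forall h, `|h| <= 1 -> `|g (h + a) - g a - h * l| <= D * h ^+ 2) ->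
  g^`() a = l.
Proof.
move=> gD; have D0 : 0 <= D.
  have := gD 1; rewrite normr1 lexx expr1n mulr1 => /(_ isT).
  exact: le_trans.
apply: cvg_lim; first exact: Rhausdorff.
apply/cvgrPdist_le => e e0; near=> h.
have h0 : h != 0 by near: h; exact: nbhs_dnbhs_neq.
have h1 : `|h| <= 1 by near: h; apply: dnbhs0_le.
(* Dividing by [D + 1] keeps the radius meaningful when [D = 0]. *)
have he : `|h| <= e / (D + 1).
  by near: h; apply: dnbhs0_le; rewrite divr_gt0// ltr_wpDl.
have -> : l - h^-1 *: (g (h + a) - g a) = - (h^-1 * (g (h + a) - g a - h * l)).
  by rewrite /GRing.scale/=; field.
rewrite normrN normrM normfV ler_pdivrMl ?normr_gt0//.
apply: le_trans (gD h h1) _; rewrite -real_normK ?num_real// expr2 mulrA mulrC.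
rewrite ler_wpM2l//; apply: le_trans (_ : (D + 1) * `|h| <= e).
  by rewrite ler_wpM2r// lerDl.
by rewrite mulrC -ler_pdivlMr// ltr_wpDl.
Unshelve. all: by end_near. Qed.

Lemma big_tuple_cons (V : Type) (idx : V) (op : Monoid.com_law idx)
    (T : finType) m (F : seq T -> V) :
  \big[op/idx]_(w : m.+1.-tuple T) F w =
  \big[op/idx]_x \big[op/idx]_(w : m.-tuple T) F (x :: w).
Proof.
rewrite pair_big/= (reindex (fun p : T * m.-tuple T => [tuple of p.1 :: p.2]))//=.
exists (fun w : m.+1.-tuple T => (thead w, [tuple of behead w])) => /= [[x w] _|w _].
  by congr (_, _); apply: val_inj.
by rewrite [in RHS](tuple_eta w).
Qed.

Lemma big_tuple0 (V : Type) (idx : V) (op : Monoid.com_law idx)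
    (T : finType) (F : seq T -> V) :
  \big[op/idx]_(w : 0.-tuple T) F w = F [::].
Proof. by rewrite (big_pred1 [tuple])// => w; apply/esym/eqP/tuple0. Qed.

Section WordSeries.
Context (R : realType) (T : finType).
Implicit Types (b : seq T -> R[i]) (l : T -> R) (x : T) (F G : (T -> R) -> R[i]).

Definition word_sum m b l : R[i] :=
  \sum_(w : m.-tuple T) b w * (\prod_(x <- w) l x)%:C.

Lemma word_sum0 b l : word_sum 0 b l = b [::].
Proof.
apply: etrans (big_tuple0 _ (fun w => b w * (\prod_(x <- w) l x)%:C)) _.
by rewrite big_nil mulr1.
Qed.

Lemma word_sumS m b l :
  word_sum m.+1 b l = \sum_x (l x)%:C * word_sum m (b \o cons x) l.
Proof.
apply: etrans (big_tuple_cons _ m (fun w => b w * (\prod_(x <- w) l x)%:C)) _.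
apply: eq_bigr => x _; rewrite mulr_sumr; apply: eq_bigr => w _.
by rewrite big_cons rmorphM/= mulrCA.
Qed.

Definition perm_inv b := forall w w', perm_eq w w' -> b w = b w'.

(** The two constants are kept apart because prefixing a letter multiplies [C] by [K] and leaves [K]
    alone. *)
Definition geom_bounded (C K : R) b := forall w, normc (b w) <= C * K ^+ size w.

Lemma perm_inv_cons x b : perm_inv b -> perm_inv (b \o cons x).
Proof. by move=> bP w w' ww'; apply: bP; rewrite perm_cons. Qed.

Lemma geom_bounded_cons C K x b :
  geom_bounded C K b -> geom_bounded (C * K) K (b \o cons x).
Proof. by move=> bC w; rewrite -mulrA -exprS; apply: bC. Qed.

Lemma normc_word_sum m C K b l (r : R) :
  0 <= C -> 0 <= K -> 0 <= r -> \sum_x `|l x| <= r ->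
  geom_bounded C K b -> normc (word_sum m b l) <= C * K ^+ m * r ^+ m.
Proof.
move=> C0 K0 r0 lr; elim: m C C0 b => [|m IH] C C0 b bC.
  by rewrite word_sum0 mulr1; apply: bC.
rewrite word_sumS; apply: le_trans (normc_sum _ _ _) _.
have -> : C * K ^+ m.+1 * r ^+ m.+1 = r * (C * K * K ^+ m * r ^+ m).
  by rewrite !exprS; ring.
apply: (@le_trans _ _ (\sum_x `|l x| * (C * K * K ^+ m * r ^+ m))).
  apply: ler_sum => x _; rewrite normcM normcC ler_wpM2l//.
  by apply: IH (geom_bounded_cons x bC); rewrite mulr_ge0.
by rewrite -mulr_suml ler_wpM2r// ?mulr_ge0// exprn_ge0.
Qed.

(** The change of one coordinate that [pderiv] makes. *)
Definition upd l x (s : R) : T -> R := fun y => if y == x then s else l y.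

Lemma upd_id l x : upd l x (l x) = l.
Proof. by apply/funext => y; rewrite /upd; case: eqP => // ->. Qed.

Lemma sum_upd l x h (G : T -> R[i]) :
  \sum_y (upd l x (h + l x) y)%:C * G y = h%:C * G x + \sum_y (l y)%:C * G y.
Proof.
rewrite (bigD1 x)//= [in RHS](bigD1 x)//= /upd eqxx rmorphD/= mulrDl -addrA.
by congr (_ + (_ + _)); apply: eq_bigr => y /negbTE ->.
Qed.

Lemma sum_norm_upd l x h :
  \sum_y `|upd l x (h + l x) y| <= `|h| + \sum_y `|l y|.
Proof.
rewrite (bigD1 x)//= [in leRHS](bigD1 x)//= /upd eqxx addrA lerD ?ler_normD//.
by rewrite le_eqVlt; apply/orP; left; apply/eqP/eq_bigr => y /negbTE ->.
Qed.

(** * Increments of word sums in one variable *)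

Section Increment.
Variables (l : T -> R) (x : T) (h r K : R).
Hypotheses (K0 : 0 <= K) (r1 : 1 <= r) (lr : \sum_y `|l y| <= r).
Let l' := upd l x (h + l x).
Hypothesis lr' : \sum_y `|l' y| <= r.

Let r0 : 0 <= r. Proof. exact: le_trans r1. Qed.

Let normc_lsum (f : T -> R[i]) (c : R) : 0 <= c -> (forall y, normc (f y) <= c) ->
  normc (\sum_y (l y)%:C * f y) <= r * c.
Proof.
move=> c0 fc; apply: le_trans (normc_sum _ _ _) _.
apply: le_trans (_ : _ <= \sum_y `|l y| * c) _.
  by apply: ler_sum => y _; rewrite normcM normcC ler_wpM2l.
by rewrite -mulr_suml ler_wpM2r.
Qed.

Let bound_ge0 c k n : 0 <= c -> 0 <= h ^+ 2 * k%:R ^+ 2 * (c * K ^+ n * r ^+ n).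
Proof.
move=> c0; apply: mulr_ge0; apply: mulr_ge0; rewrite ?sqr_ge0 ?exprn_ge0//.
by rewrite mulr_ge0 ?exprn_ge0.
Qed.

(** The first letter contributes [h] times a word sum at [l']; the tails contribute increments of
    lower degree, weighted by [l], to which the induction applies. *)
Lemma word_sum_increment1 m C b : 0 <= C -> geom_bounded C K b ->
  normc (word_sum m b l' - word_sum m b l) <=
  `|h| * m%:R * (C * K ^+ m * r ^+ m).
Proof.
elim: m C b => [|m IH] C b C0 bC.
  by rewrite !word_sum0 subrr normc0 mulr0 mul0r.
rewrite !word_sumS sum_upd -addrA -sumrB.
under eq_bigr do rewrite -mulrBr.
apply: le_trans (le_normcD _ _) _; rewrite normcM normcC.
have CK0 : 0 <= C * K by rewrite mulr_ge0.
have B0 : 0 <= C * K * K ^+ m * r ^+ m by rewrite !mulr_ge0 ?exprn_ge0.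
(* An extra factor [r >= 1] gives both contributions the same power of [r]. *)
have le1 : normc (word_sum m (b \o cons x) l') <= r * (C * K * K ^+ m * r ^+ m).
  apply: le_trans (normc_word_sum m CK0 K0 r0 lr' (geom_bounded_cons x bC)) _.
  by rewrite ler_peMl.
have le2 := normc_lsum (mulr_ge0 (mulr_ge0 (normr_ge0 h) (ler0n _ m)) B0)
  (fun y => IH _ _ CK0 (geom_bounded_cons y bC)).
apply: le_trans (lerD (ler_wpM2l (normr_ge0 h) le1) le2) _.
by rewrite le_eqVlt; apply/orP; left; apply/eqP; rewrite -natr1 !exprS; ring.
Qed.

(** Second-order form of the same recursion: the changed first letter leaves [h] times a first-order
    increment, and the tails leave remainders of lower degree. The coefficient [m.+1] counts the
    positions of [x], all equivalent by permutation invariance. *)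
Lemma word_sum_increment2 m C b : 0 <= C -> perm_inv b -> geom_bounded C K b ->
  normc (word_sum m.+1 b l' - word_sum m.+1 b l
         - m.+1%:R * h%:C * word_sum m (b \o cons x) l) <=
  h ^+ 2 * m.+1%:R ^+ 2 * (C * K ^+ m.+1 * r ^+ m.+1).
Proof.
elim: m C b => [|m IH] C b C0 bP bC.
  have E1 z : word_sum 1 b z = \sum_y (z y)%:C * b [:: y].
    by rewrite word_sumS; apply: eq_bigr => y _; rewrite word_sum0.
  rewrite !E1 sum_upd word_sum0 addrK mul1r subrr normc0.
  exact: bound_ge0.
have CK0 : 0 <= C * K by rewrite mulr_ge0.
pose c := h ^+ 2 * m.+1%:R ^+ 2 * (C * K * K ^+ m.+1 * r ^+ m.+1).
have c0 : 0 <= c by apply: bound_ge0.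
rewrite [X in normc X](_ : _ =
    h%:C * (word_sum m.+1 (b \o cons x) l' - word_sum m.+1 (b \o cons x) l)
    + \sum_y (l y)%:C * (word_sum m.+1 (b \o cons y) l'
       - word_sum m.+1 (b \o cons y) l
       - m.+1%:R * h%:C * word_sum m (b \o cons y \o cons x) l)); last first.
  under [in RHS]eq_bigr do rewrite !mulrBr.
  rewrite !sumrB 2![word_sum m.+2 b _]word_sumS sum_upd.
  have -> : \sum_y (l y)%:C * (m.+1%:R * h%:C * word_sum m (b \o cons y \o cons x) l)
      = m.+1%:R * h%:C * word_sum m.+1 (b \o cons x) l.
    rewrite word_sumS mulr_sumr; apply: eq_bigr => y _; rewrite mulrCA.
    (* Permutation invariance exchanges the two leading letters [x] and [y]. *)
    congr (_ * (_ * word_sum m _ l)); apply/funext => w; apply: bP.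
    by rewrite -cat1s -(cat1s x) perm_catCA.
  by rewrite -(natr1 m.+1); ring.
apply: le_trans (le_normcD _ _) _; rewrite normcM normcC.
have le1 := word_sum_increment1 m.+1 CK0 (geom_bounded_cons x bC).
have le2 := normc_lsum c0
  (fun y => IH _ _ CK0 (perm_inv_cons y bP) (geom_bounded_cons y bC)).
apply: le_trans (lerD (ler_wpM2l (normr_ge0 h) le1) le2) _.
have -> : `|h| * (`|h| * m.+1%:R * (C * K * K ^+ m.+1 * r ^+ m.+1)) + r * c =
   h ^+ 2 * (m.+1%:R + r * m.+1%:R ^+ 2) * (C * K * K ^+ m.+1 * r ^+ m.+1).
  by rewrite /c -!(real_normK (num_real h)); ring.
have -> : h ^+ 2 * m.+2%:R ^+ 2 * (C * K ^+ m.+2 * r ^+ m.+2) =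
   h ^+ 2 * (r * m.+2%:R ^+ 2) * (C * K * K ^+ m.+1 * r ^+ m.+1).
  by rewrite (exprS r m.+1) (exprS K m.+1); ring.
(* With [a = m.+1] what remains is [a + r * a ^ 2 <= r * (a + 1) ^ 2], true for [r >= 1]. *)
rewrite ler_wpM2r ?mulr_ge0 ?exprn_ge0// ler_wpM2l ?sqr_ge0//.
have -> : m.+2%:R = m.+1%:R + 1 :> R by rewrite natr1.
have a0 : 0 <= m.+1%:R :> R by [].
have ra : 0 <= (r - 1) * m.+1%:R by rewrite mulr_ge0 ?subr_ge0.
move: a0 ra r1; set a := m.+1%:R => a0 ra ?; lra.
Qed.

End Increment.

(** For permutation-invariant [b], the weight [1 / m!] makes differentiation in [l x] the plain
    shift [b \o cons x], with no numerical factor. *)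
Definition word_series b F : Prop :=
  forall l, cvgc (fun n => \sum_(m < n) m`!%:R^-1 * word_sum m b l) (F l).

Lemma word_series_ex C K b : 0 <= C -> 0 <= K -> geom_bounded C K b ->
  exists F, word_series b F.
Proof.
move=> C0 K0 bC; suff /choice[F FP] : forall l, exists z,
    cvgc (fun n => \sum_(m < n) m`!%:R^-1 * word_sum m b l) z by exists F.
move=> l; pose r := \sum_x `|l x|.
apply: (@cvgc_series_exp _ (fun m => m`!%:R^-1 * word_sum m b l) C (K * r)) => m.
rewrite normcM normcV normc_nat mulrA mulrC ler_wpM2r ?invr_ge0//.
rewrite exprMn mulrA; apply: normc_word_sum => //.
by apply: sumr_ge0 => x _; apply: normr_ge0.
Qed.

Lemma word_series_quadratic C K b F l x G : 0 <= C -> 0 <= K ->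
  perm_inv b -> geom_bounded C K b ->
  word_series b F -> word_series (b \o cons x) G ->
  exists D, forall h, `|h| <= 1 ->
    normc (F (upd l x (h + l x)) - F l - h%:C * G l) <= D * h ^+ 2.
Proof.
(* The summand 1 in [r] leaves room for a change of one coordinate by [|h| <= 1] and ensures
   [1 <= r]. *)
move=> C0 K0 bP bC FP GP; pose r := 1 + \sum_y `|l y|.
have sl0 : 0 <= \sum_y `|l y| by apply: sumr_ge0 => y _; apply: normr_ge0.
have r1 : 1 <= r by rewrite /r lerDl.
exists (C * expR (4 * (K * r))) => h h1; set l' := upd l x _.
have lr' : \sum_y `|l' y| <= r.
  by apply: le_trans (sum_norm_upd _ _ _) _; rewrite /r lerD2r.
(* The series of [F] is taken one term further than that of [G], because its degree [m.+1] pairs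
   with degree [m] of [G]. *)
have shift (b' : seq T -> R[i]) F' z : word_series b' F' ->
    cvgc (fun n => \sum_(m < n.+1) m`!%:R^-1 * word_sum m b' z) (F' z).
  move=> /(_ z)[cr ci]; split.
    by move: cr; rewrite -cvg_shiftS.
  by move: ci; rewrite -cvg_shiftS.
have cvN (u : nat -> R[i]) z : cvgc u z -> cvgc (fun n => - u n) (- z).
  move=> uz; rewrite -mulN1r; under eq_fun do rewrite -mulN1r.
  exact: cvgcM (cvgc_cst _) uz.
have cv := cvgcD (cvgcD (shift _ _ l' FP) (cvN _ _ (shift _ _ l FP)))
   (cvN _ _ (cvgcM (cvgc_cst h%:C) (GP l))).
rewrite -[X in normc X]subr0; apply: (cvgc_le (N := 0) cv) => n _.
rewrite subr0.
have -> : \sum_(m < n.+1) m`!%:R^-1 * word_sum m b l'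
    - \sum_(m < n.+1) m`!%:R^-1 * word_sum m b l
    - h%:C * (\sum_(m < n) m`!%:R^-1 * word_sum m (b \o cons x) l) =
    \sum_(m < n) m.+1`!%:R^-1 * (word_sum m.+1 b l' - word_sum m.+1 b l
         - m.+1%:R * h%:C * word_sum m (b \o cons x) l).
  under [in RHS]eq_bigr do rewrite !mulrBr.
  have S z : \sum_(m < n.+1) m`!%:R^-1 * word_sum m b z =
      0`!%:R^-1 * b [::] + \sum_(m < n) m.+1`!%:R^-1 * word_sum m.+1 b z.
    by rewrite big_ord_recl word_sum0.
  rewrite !sumrB !S.
  have -> : \sum_(i < n) i.+1`!%:R^-1 * (i.+1%:R * h%:C * word_sum i (b \o cons x) l)
     = h%:C * (\sum_(m < n) m`!%:R^-1 * word_sum m (b \o cons x) l).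
    rewrite mulr_sumr; apply: eq_bigr => i _.
    by rewrite (@factS_inv R i); ring.
  by rewrite opprD addrACA subrr add0r.
apply: le_trans (normc_sum _ _ _) _.
apply: (@le_trans _ _ (\sum_(m < n) C * h ^+ 2 *
    ((4 * (K * r)) ^+ m.+1 / m.+1`!%:R))).
  apply: ler_sum => m _; rewrite normcM normcV normc_nat.
  rewrite ler_pdivrMl ?ltr0n ?fact_gt0//.
  apply: le_trans (word_sum_increment2 K0 r1 _ lr' m C0 bP bC) _.
    by rewrite /r lerDr.
  have -> : m.+1`!%:R * (C * h ^+ 2 * ((4 * (K * r)) ^+ m.+1 / m.+1`!%:R)) =
     h ^+ 2 * 4 ^+ m.+1 * (C * K ^+ m.+1 * r ^+ m.+1).
    rewrite !exprMn; field.
    by rewrite pnatr_eq0 -lt0n fact_gt0.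
  rewrite ler_wpM2r ?mulr_ge0 ?exprn_ge0//; first by rewrite (le_trans _ r1).
  rewrite ler_wpM2l ?sqr_ge0//.
  (* [m.+1 ^ 2 <= 4 ^ m.+1] absorbs the quadratic factor into the exponential series at
     [4 * (K * r)]. *)
  have -> : 4 ^+ m.+1 = (2 ^+ m.+1) ^+ 2 :> R.
    by rewrite -exprM mulnC exprM; congr (_ ^+ _); ring.
  rewrite lerXn2r ?nnegrE ?exprn_ge0// -natrX ler_nat.
  exact/ltnW/ltn_expl.
rewrite -mulr_sumr [leRHS]mulrAC ler_wpM2l ?(mulr_ge0 C0 (sqr_ge0 h))//.
have x0 : 0 <= 4 * (K * r) by rewrite !mulr_ge0// (le_trans _ r1).
apply: le_trans _ (exp_partial_sum_le n.+1 x0).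
rewrite big_ord_recl/= lerDr; rewrite expr0 divr_ge0//.
Qed.

End WordSeries.

(** The shifted coefficients have a convergent series with some sum [G]; the quadratic remainder
    identifies the derivatives of both parts of [F] with the parts of [G]. *)
Lemma word_series_pderiv (R : realType) (V : finType) (C K : R)
    (b : seq {set V} -> R[i]) (F : ({set V} -> R) -> R[i]) (X : {set V}) :
  0 <= C -> 0 <= K -> perm_inv b -> geom_bounded C K b ->
  word_series b F -> word_series (b \o cons X) (pderiv X F).
Proof.
move=> C0 K0 bP bC FP.
have CK0 := mulr_ge0 C0 K0; have bXC := geom_bounded_cons X bC.
have [G GP] := word_series_ex CK0 K0 bXC.
suff -> : pderiv X F = G by [].
apply/funext => l; have [D DP] := word_series_quadratic l C0 K0 bP bC FP GP.
have upl s : (fun Y => if Y == X then s else l Y) = upd l X s by [].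
rewrite /pderiv [RHS](_ : _ = complex.Re (G l) +i* complex.Im (G l)); last first.
  by case: (G l).
have Ge (h : R) : complex.Re (h%:C * G l) = h * complex.Re (G l) /\
  complex.Im (h%:C * G l) = h * complex.Im (G l).
  by case: (G l) => u v /=; rewrite !mul0r subr0 addr0.
congr (_ +i* _); apply: (@derive1_quadratic _ _ _ _ D) => h h1.
- rewrite !upl upd_id -(Ge h).1 -!ReB.
  exact: le_trans (norm_Re_le _) (DP h h1).
- rewrite !upl upd_id -(Ge h).2 -!ImB.
  exact: le_trans (norm_Im_le _) (DP h h1).
Qed.

(** * Cluster derivatives *)

Section WordCounting.
Variable T : finType.
Implicit Types (s w : seq T).

Definition nb_perms n s : nat := (\sum_(w : n.-tuple T) perm_eq w s)%N.

Lemma sum_count_mem s : (\sum_x count_mem x s)%N = size s.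
Proof.
elim: s => [|x s IH]; first by rewrite big1.
rewrite /= big_split/= IH (bigD1 x)//= eqxx big1 ?addn0 ?add1n// => y yx.
by rewrite eq_sym (negbTE yx).
Qed.

(** Multinomial formula, by the first letter [x]: it leaves the rearrangements of [rem x s], where
    the multiplicity of [x] is one less, and the multiplicities in [s] add up to [n]. *)
Lemma nb_perms_fact n s : size s = n ->
  (nb_perms n s * \prod_x (count_mem x s)`!)%N = n`!.
Proof.
rewrite /nb_perms; elim: n s => [|n IH] s sn.
  rewrite (size0nil sn) [X in (_ * X)%N]big1// muln1.
  exact: (big_tuple0 _ (fun w => nat_of_bool (perm_eq w [::]))).
rewrite (big_tuple_cons _ n (fun w => nat_of_bool (perm_eq w s))) big_distrl/=.
rewrite factS -sn -sum_count_mem big_distrl/=; apply: eq_bigr => x _.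
have [xs|xs] := boolP (x \in s); last first.
  rewrite (count_memPn xs) mul0n big1 ?mul0n// => w _.
  have [/perm_mem/(_ x)|//] := boolP (perm_eq (x :: w) s).
  by rewrite mem_head (negbTE xs).
have srem := perm_to_rem xs.
have szrem : size (rem x s) = n by rewrite size_rem// sn.
rewrite -(IH _ szrem) mulnCA; congr (_ * _)%N.
  by apply: eq_bigr => w _; rewrite (permPr srem) perm_cons.
rewrite (bigD1 x)//= [in RHS](bigD1 x)//= mulnA; congr (_ * _)%N.
  rewrite (permP srem (pred1 x)) /= eqxx add1n factS.
  by [].
apply: eq_bigr => y yx; rewrite (permP srem (pred1 y)) /=.
by rewrite eq_sym (negbTE yx).
Qed.

Lemma sum_perms_const (R : pzSemiRingType) n s (z : R) :
  \sum_(w : n.-tuple T | perm_eq w s) z = (nb_perms n s)%:R * z.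
Proof.
rewrite /nb_perms natr_sum mulr_suml big_mkcond/=; apply: eq_bigr => w _.
by case: ifP; rewrite ?mul1r ?mul0r.
Qed.

Lemma nb_perms_gt0 n s : size s = n -> (0 < nb_perms n s)%N.
Proof.
move=> sn; rewrite lt0n; apply/eqP => n0; have := nb_perms_fact sn.
by rewrite n0 mul0n => /esym/eqP; rewrite -leqn0 leqNgt fact_gt0.
Qed.

Lemma prod_seq_count (R : comPzRingType) (f : T -> R) s :
  \prod_(x <- s) f x = \prod_x f x ^+ count_mem x s.
Proof.
elim: s => [|x s IH]; first by rewrite big_nil big1.
rewrite big_cons IH (bigD1 x)//= [in RHS](bigD1 x)//= eqxx exprD expr1 mulrA.
by congr (_ * _); apply: eq_bigr => y yx; rewrite eq_sym (negbTE yx).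
Qed.

End WordCounting.

(** * Averaging coefficients over rearrangements *)

Section Symmetrization.
Context (R : realType) (T : finType).
Implicit Types (c : seq T -> R[i]) (w : seq T).

Definition symmetrize c w : R[i] :=
  (nb_perms (size w) w)%:R^-1 * \sum_(v : (size w).-tuple T | perm_eq v w) c v.

Lemma symmetrize_perm c : perm_inv (symmetrize c).
Proof.
move=> w w' ww'; rewrite /symmetrize (perm_size ww') /nb_perms.
congr (_%:R^-1 * _); first by apply: eq_bigr => v _; rewrite (permPr ww').
by apply: eq_bigl => v; rewrite (permPr ww').
Qed.

Lemma symmetrize_neq0 c w :
  symmetrize c w != 0 -> exists2 v, perm_eq v w & c v != 0.
Proof.
rewrite mulf_eq0 negb_or => /andP[_]; have [[v vw cv]|no] := pselect
  (exists2 v, perm_eq v w & c v != 0); first by exists v.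
rewrite big1 ?eqxx// => v vw; apply/eqP/negP => /negP cv.
by apply: no; exists (val v).
Qed.

Lemma normc_symmetrize c w (B : R) :
  (forall v, size v = size w -> normc (c v) <= B) -> normc (symmetrize c w) <= B.
Proof.
move=> cB; rewrite normcM normcV normc_nat.
have n0 := nb_perms_gt0 (erefl (size w)).
rewrite ler_pdivrMl ?ltr0n//; apply: le_trans (normc_sum _ _ _) _.
rewrite /nb_perms natr_sum mulr_suml big_mkcond/=; apply: ler_sum => v _.
by case: ifP => _; rewrite ?mul0r// mul1r cB// size_tuple.
Qed.

(** The monomial depends only on the multiset of letters. After the sums are exchanged, each [v] is
    collected from its [nb_perms m v] rearrangements, each time with weight [1 / nb_perms m v]. *)
Lemma word_sum_symmetrize m c (l : T -> R) :
  word_sum m (symmetrize c) l = word_sum m c l.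
Proof.
pose G (w : m.-tuple T) : R[i] := c w * (\prod_(x <- w) l x)%:C.
transitivity (\sum_(w : m.-tuple T) \sum_(v : m.-tuple T | perm_eq v w)
    (nb_perms m w)%:R^-1 * G v).
  apply: eq_bigr => w _; rewrite /symmetrize size_tuple -mulrA mulr_suml mulr_sumr.
  by apply: eq_bigr => v vw; rewrite /G (perm_big _ vw).
rewrite (exchange_big_dep xpredT)//=; apply: eq_bigr => v _.
transitivity (\sum_(w : m.-tuple T | perm_eq w v) (nb_perms m v)%:R^-1 * G v).
  apply: eq_big => w; first by rewrite perm_sym.
  move=> vw; congr (_%:R^-1 * _); apply: eq_bigr => u _.
  by rewrite (permPr vw).
rewrite sum_perms_const mulrA mulfV ?mul1r//.
by rewrite pnatr_eq0 -lt0n nb_perms_gt0// size_tuple.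
Qed.

End Symmetrization.

(** * Cluster derivatives of word series *)

Section ClusterDerivative.
Local Open Scope mset_scope.
Context (R : realType) (V : finType).
Implicit Types (b : seq {set V} -> R[i]) (F : ({set V} -> R) -> R[i]).

(** The conditions that [word_series_pderiv] puts on coefficients, in a form stable under prefixing
    letters. *)
Definition tame b : Prop :=
  perm_inv b /\ exists C K : R, [/\ 0 <= C, 0 <= K & geom_bounded C K b].

Lemma tame_cons b X : tame b -> tame (b \o cons X).
Proof.
move=> [bP [C [K [C0 K0 bC]]]]; split; first exact: perm_inv_cons.
by exists (C * K), K; rewrite mulr_ge0//; split => //; apply: geom_bounded_cons.
Qed.

Lemma tame_cat b u : tame b -> tame (fun w => b (u ++ w)).
Proof.
elim: u b => [|X u IH] b bT; first exact: bT.
exact: IH (tame_cons X bT).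
Qed.

Lemma word_series_iter b F X n : tame b -> word_series b F ->
  word_series (fun w => b (nseq n X ++ w)) (iter n (pderiv X) F).
Proof.
move=> bT FP; elim: n => [//|n IH].
have [bP' [C [K [C0 K0 bC']]]] := tame_cat (nseq n X) bT.
have := word_series_pderiv X C0 K0 bP' bC' IH; rewrite iterS.
congr word_series; apply/funext => w /=; apply: bT.1.
by rewrite -cat1s perm_catCA.
Qed.

Lemma word_series_at0 b F : word_series b F -> F (fun=> 0) = b [::].
Proof.
move=> /(_ (fun=> 0)) FP; apply/eqP; rewrite -subr_eq0; apply/eqP/eq0_normc.
(* From [N := 1] on the partial sums contain degree 0, the only degree that survives at the
   origin. *)
apply/eqP; rewrite eq_le normc_ge0 andbT; apply: (cvgc_le (N := 1) FP).
case=> // n _; rewrite big_ord_recl word_sum0 invr1 mul1r big1 ?addr0 ?subrr ?normc0//.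
by move=> i _; rewrite word_sumS big1 ?mulr0// => x _; rewrite mul0r.
Qed.

(** Each derivative prefixes a letter; together they prefix the word [u], which is a rearrangement
    of [W] because all letters of [W] lie in [S]. *)
Lemma cluster_derivative_word (S : {set {set V}}) (W : {mset {set V}}) b F :
  tame b -> word_series b F -> {in W, forall X, X \in S} ->
  cluster_derivative S W F = b W.
Proof.
move=> bT FP WS.
pose u := foldr (fun X u => u ++ nseq (W X) X) [::].
have uP s : word_series (fun w => b (u s ++ w))
    (foldr (fun X g => iter (W X) (pderiv X) g) F s).
  elim: s => [//|X s IH] /=.
  have := word_series_iter X (W X) (tame_cat (u s) bT) IH.
  by congr word_series; apply/funext => w; rewrite catA.
rewrite /cluster_derivative (word_series_at0 (uP _)) cats0; apply: bT.1.
have count_u s X : uniq s -> count_mem X (u s) = if X \in s then W X else 0%N.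
  elim: s => [//|Y s IH] /= /andP[Ys us].
  rewrite count_cat IH// count_nseq inE /=.
  rewrite in_cons (eq_sym X); have [<-|YX] := eqVneq Y X; last by rewrite addn0.
  by rewrite (negbTE Ys) mul1n.
apply/allP => X _ /=; rewrite count_u ?enum_uniq// mem_enum count_mem_mset.
case: ifPn => // XS; rewrite eq_sym mset_eq0.
by apply: contra XS; apply: WS.
Qed.

(** Group the words by their multiset: [W] has [m! / W!] enumerations with equal contributions,
    which turns [1 / m!] into [1 / W!]. *)
Lemma sum_cluster_word (S : {set {set V}}) (l : {set V} -> R) m b F
    (A : {fset {mset {set V}}}) :
  tame b -> word_series b F ->
  (forall W : {mset {set V}}, W \in A -> size W = m /\ {in W, forall X, X \in S}) ->
  (forall w, size w = m -> b w != 0 -> seq_mset w \in A) ->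
  \sum_(W <- A) (cluster_coef S l W / (cluster_fact S W)%:R)%:C
     * cluster_derivative S W F = m`!%:R^-1 * word_sum m b l.
Proof.
move=> bT FP AP bA.
pose G (w : seq {set V}) : R[i] := b w * (\prod_(x <- w) l x)%:C.
have GP w w' : perm_eq w w' -> G w = G w'.
  by move=> ww'; rewrite /G (bT.1 _ _ ww') (perm_big _ ww').
have -> : word_sum m b l =
    \sum_(W <- A) \sum_(w : m.-tuple {set V} | seq_mset w == W) G w.
  rewrite (exchange_big_dep xpredT)//=; apply: eq_bigr => w _.
  (* Words whose multiset lies outside [A] have coefficient zero, so the regrouping loses
     nothing. *)
  have [bw|bw] := eqVneq (b w) 0.
    by rewrite -/(G w) /G bw mul0r big1.
  have -> : \sum_(W <- A | seq_mset w == W) G w =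
      \sum_(W <- [seq W <- A | pred1 (seq_mset w) W]) G w.
    by rewrite big_filter; apply: eq_bigl => W; rewrite /= eq_sym.
  by rewrite filter_pred1_uniq ?fset_uniq ?bA ?size_tuple// big_seq1.
rewrite mulr_sumr big_seq [RHS]big_seq; apply: eq_bigr => W WA.
move: (W : {mset {set V}}) WA => {}W WA.
have [Wm WS] := AP W WA.
rewrite (cluster_derivative_word bT FP WS).
have off X : X \notin S -> W X = 0%N.
  by move=> XS; apply/eqP; rewrite mset_eq0; apply: contra XS; apply: WS.
have coefE : cluster_coef S l W = \prod_(x <- W) l x.
  rewrite prod_seq_count /cluster_coef big_mkcond/=; apply: eq_bigr => X _.
  by rewrite count_mem_mset; case: ifPn => // /off ->.
have factE : cluster_fact S W = (\prod_X (count_mem X W)`!)%N.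
  rewrite /cluster_fact big_mkcond/=; apply: eq_bigr => X _.
  by rewrite count_mem_mset; case: ifPn => // /off ->.
transitivity (m`!%:R^-1 * \sum_(w : m.-tuple {set V} | seq_mset w == W) G W); last first.
  congr (_ * _); apply: eq_bigr => w /eqP wW; apply: GP.
  by rewrite -wW; exact: perm_eq_seq_mset.
rewrite (eq_bigl (fun w : m.-tuple {set V} => perm_eq w W)); last first.
  move=> w /=; rewrite -[W in LHS]seq_mset_id.
  by apply/eqP/idP => /eq_seq_msetP.
rewrite sum_perms_const.
have nW := nb_perms_fact Wm; rewrite -factE in nW.
have fW : (cluster_fact S W)%:R != 0 :> R[i].
  rewrite pnatr_eq0; apply/eqP => f0; move: nW.
  by rewrite f0 muln0 => /esym/eqP; rewrite -leqn0 leqNgt fact_gt0.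
have N0 : (nb_perms m W)%:R != 0 :> R[i] by rewrite pnatr_eq0 -lt0n nb_perms_gt0.
rewrite -nW natrM rmorphM fmorphV rmorph_nat /= coefE /G.
by field; rewrite fW N0.
Qed.

End ClusterDerivative.

(** * Locality and connectedness *)

Section Locality.
Context (R : realType) (V : finType) (d : nat).
Implicit Types (B C : op R V d) (X Y Z : {set V}).

Lemma acts_within_commute B C X Z :
  acts_within B X -> acts_within C Z -> (X :&: Z)%SET = finset.set0 ->
  B *m C = C *m B.
Proof.
move=> [b ->] [c ->] XZ.
have disj v : v \in X -> v \notin Z.
  by move=> vX; apply/negP => vZ; have := finset.in_set0 v; rewrite -XZ inE vX vZ.
apply/matrixP => i j; rewrite [LHS]mxE [RHS]mxE.
set s : config V d := enum_val i; set s' : config V d := enum_val j.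
(* Disjointness leaves a single intermediate configuration in each product: [k1] for [B *m C] and
   [k2] for [C *m B]. *)
pose k1 : config V d := [ffun v => if v \in X then s' v else s v].
pose k2 : config V d := [ffun v => if v \in X then s v else s' v].
rewrite (bigD1 (enum_rank k1))//= [X in _ + X]big1 ?addr0; last first.
  move=> k kk; rewrite !mxE/= -/s -/s'.
  case: ifP => [/forallP a1|]; last by rewrite mul0r.
  case: ifP => [/forallP a2|]; last by rewrite mulr0.
  case/negP: kk; apply/eqP; rewrite -[k]enum_valK; congr enum_rank.
  apply/ffunP => v; rewrite ffunE; case: ifPn => vX.
    exact/eqP/(implyP (a2 v))/disj.
  by apply/esym/eqP/(implyP (a1 v)).
rewrite (bigD1 (enum_rank k2))//= [X in _ + X]big1 ?addr0; last first.
  move=> k kk; rewrite !mxE/= -/s -/s'.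
  case: ifP => [/forallP a1|]; last by rewrite mul0r.
  case: ifP => [/forallP a2|]; last by rewrite mulr0.
  case/negP: kk; apply/eqP; rewrite -[k]enum_valK; congr enum_rank.
  apply/ffunP => v; rewrite ffunE; case: ifPn => vX.
    exact/esym/eqP/(implyP (a1 v))/disj.
  by apply/eqP/(implyP (a2 v)).
rewrite !mxE !enum_rankK /= -/s -/s' mulrC; congr (_ * _).
  have -> : [forall v, (v \notin Z) ==> (k1 v == s' v)] =
            [forall v, (v \notin Z) ==> (s v == k2 v)].
    by apply: eq_forallb => v; rewrite !ffunE; case: (v \in X); rewrite ?eqxx.
  case: ifP => // _; congr (c (enum_rank _) (enum_rank _)); apply/ffunP => v.
    by rewrite !ffunE ifN//; apply: contraL (valP v) => /disj.
  by rewrite !ffunE ifN//; apply: contraL (valP v) => /disj.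
rewrite !ifT.
- by congr (b (enum_rank _) (enum_rank _)); apply/ffunP => v; rewrite !ffunE (valP v).
- by apply/forallP => v; apply/implyP => vX; rewrite !ffunE (negbTE vX).
- by apply/forallP => v; apply/implyP => vX; rewrite !ffunE (negbTE vX).
Qed.

(* Locality expressed through the commutant; unlike [acts_within] it passes to
   products at no cost. *)
Definition commutes_off B Y : Prop :=
  forall Z C, acts_within C Z -> (Y :&: Z)%SET = finset.set0 -> B *m C = C *m B.

Lemma commutes_off_ad B C X Y :
  commutes_off B X -> commutes_off C Y -> commutes_off (ad B C) (X :|: Y)%SET.
Proof.
move=> BX CY Z D DZ; rewrite finset.setIUl => /eqP.
rewrite finset.setU_eq0 => /andP[/eqP XZ /eqP YZ].
have BD := BX _ _ DZ XZ; have CD := CY _ _ DZ YZ.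
rewrite /ad mulmxBl mulmxBr; congr (_ - _).
  by rewrite -mulmxA CD mulmxA BD mulmxA.
by rewrite -mulmxA BD mulmxA CD mulmxA.
Qed.

End Locality.

Local Notation meets := Defs.meets.

(** * Connectedness of words of subsystems *)

Section Unsplittable.
Context (V : finType).
Implicit Types (s : seq {set V}) (X Y : {set V}).

(** Connectedness of the intersection graph of a word, phrased by cuts: this form ignores the order
    of the letters and handles repetitions without indices. *)
Definition unsplittable s : Prop := forall s1 s2, perm_eq s (s1 ++ s2) ->
  s1 != [::] -> s2 != [::] -> exists X Y, [/\ X \in s1, Y \in s2 & meets X Y].

Lemma meetsC X Y : meets X Y = meets Y X.
Proof. by rewrite /meets finset.setIC. Qed.

Lemma unsplittable1 X : unsplittable [:: X].
Proof.
move=> [|x1 s1] [|x2 s2]// /perm_size; rewrite size_cat/= addnS.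
by case.
Qed.

(** Consider the block containing [X]. If it has further letters, deleting [X] leaves a cut of [s]
    with a crossing pair; otherwise the other block is all of [s] and contains the neighbour [Y]. *)
Lemma unsplittable_cons X s :
  unsplittable s -> has (meets X) s -> unsplittable (X :: s).
Proof.
move=> us /hasP[Y Ys XY].
have main s1 s2 : X \in s1 -> perm_eq (X :: s) (s1 ++ s2) -> s2 != [::] ->
    exists X Y, [/\ X \in s1, Y \in s2 & meets X Y].
  move=> Xs1 Xs s2N.
  have ps : perm_eq s (rem X s1 ++ s2).
    rewrite -(perm_cons X); apply: (perm_trans Xs).
    by rewrite -cat_cons perm_cat2r perm_to_rem.
  have [r0|rN] := eqVneq (rem X s1) [::].
    by exists X, Y; split => //; move: ps; rewrite r0 => /perm_mem <-.
  have [Z [U [Zs Us ZU]]] := us _ _ ps rN s2N.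
  by exists Z, U; split => //; apply: mem_rem Zs.
move=> s1 s2 Xs s1N s2N.
have : X \in s1 ++ s2 by rewrite -(perm_mem Xs) mem_head.
rewrite mem_cat => /orP[Xs1|Xs2]; first exact: main.
have [|Z [U [Zs Us ZU]]] := main s2 s1 Xs2 _ s1N.
  by rewrite (perm_trans Xs)// perm_catC.
by exists U, Z; rewrite meetsC.
Qed.

Lemma unsplittable_perm s s' : perm_eq s s' -> unsplittable s -> unsplittable s'.
Proof. by move=> ss' us s1 s2 /(perm_trans ss'); apply: us. Qed.

Local Open Scope mset_scope.

(** If [j] were unreachable from [i], cutting the positions into those reachable from [i] and the
    others would produce an edge leaving the reachable ones. *)
Lemma unsplittable_connect (W : {mset {set V}}) :
  unsplittable W -> forall i j, connect (@cluster_adj V W) i j.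
Proof.
move=> uW i j; apply/negPn/negP => nij.
pose at_ (k : 'I_(size W)) := nth finset.set0 W k.
pose P := connect (@cluster_adj V W) i.
have WE : (W : seq _) = map at_ (enum 'I_(size W)).
  rewrite -[LHS](mkseq_nth finset.set0) /mkseq -val_enum_ord -map_comp.
  by [].
have pW : perm_eq W ([seq at_ k | k <- enum 'I_(size W) & P k]
                     ++ [seq at_ k | k <- enum 'I_(size W) & predC P k]).
  by rewrite {1}WE -map_cat perm_map// perm_sym; apply/permPl/perm_filterC.
have [||X [Y [/mapP[a] + -> /mapP[c] + -> ac]]] := uW _ _ pW.
- rewrite -size_eq0 size_map size_filter -lt0n -has_count; apply/hasP.
  by exists i; rewrite ?mem_enum//; apply: connect0.
- rewrite -size_eq0 size_map size_filter -lt0n -has_count; apply/hasP.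
  by exists j; rewrite ?mem_enum.
rewrite !mem_filter => /andP[Pa _] /andP[/= Pc _].
have adj_ac : cluster_adj a c.
  rewrite /cluster_adj ac andbT; apply/eqP => ca; move: Pc.
  by rewrite -ca Pa.
exact: (negP Pc (connect_trans Pa (connect1 adj_ac))).
Qed.

Lemma completely_connected_unsplittable (w : seq {set V}) (X : {set V}) :
  unsplittable (rcons w X) -> completely_connected (seq_mset w) X.
Proof.
move=> uw; apply: unsplittable_connect; apply: unsplittable_perm uw.
apply/eq_seq_msetP; rewrite seq_mset_id; apply/msetP => Y.
rewrite msetE2 !mset_seqE -cats1 count_cat /= addn0 msetnE eq_sym.
by case: eqP.
Qed.

End Unsplittable.

(** * Counting neighbours in the interaction graph *)

Section InteractionDegree.
Context (V : finType) (S : {set {set V}}).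

(** [Y] itself may be counted on the left but is not its own neighbour; hence the successor. *)
Lemma card_meets (Y : {set V}) : Y \in S ->
  (#|[set X in S | meets X Y]%SET| <= (interaction_degree S).+1)%N.
Proof.
move=> YS; pose N := [set X in S | (X != Y) && meets Y X]%SET.
apply: (@leq_trans #|Y |: N|%SET).
  apply/subset_leq_card/fintype.subsetP => X; rewrite !inE meetsC.
  by case: eqVneq.
rewrite cardsU1 -add1n leq_add ?leq_b1//.
exact: (@leq_bigmax_cond _ (fun X => X \in S) (fun X : {set V} =>
  #|[set Y in S | (Y != X) && meets X Y]%SET|) Y YS).
Qed.

Lemma card_has_meets (s : seq {set V}) : {subset s <= S} ->
  (#|[set X in S | has (meets X) s]%SET| <= size s * (interaction_degree S).+1)%N.
Proof.
elim: s => [|Y s IH] sS.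
  by rewrite leqn0 cards_eq0; apply/eqP/setP => X; rewrite !inE andbF.
have -> : [set X in S | has (meets X) (Y :: s)]%SET =
  ([set X in S | meets X Y] :|: [set X in S | has (meets X) s])%SET.
  by apply/setP => X; rewrite !inE /= andb_orr.
rewrite cardsU mulSn; apply: leq_trans (leq_subr _ _) _; apply: leq_add.
  by apply: card_meets; apply: sS; rewrite mem_head.
by apply: IH => Z Zs; apply: sS; rewrite inE Zs orbT.
Qed.

End InteractionDegree.

(** * Nested commutators *)

Section NestedCommutators.
Context (R : realType) (V : finType) (d : nat) (S : {set {set V}}).
Context (h : {set V} -> op R V d) (A : op R V d).
Implicit Types (l : {set V} -> R) (w : seq {set V}) (X : {set V}).

(** Extension by zero off [S], so that words range over the whole finite type [{set V}]. *)
Definition restr X : op R V d := if X \in S then h X else 0.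

Definition nest w : op R V d := foldr (fun X B => ad (restr X) B) A w.

Lemma iter_ad_hamiltonian l m :
  iter m (ad (hamiltonian S h l)) A =
  \sum_(w : m.-tuple {set V}) (\prod_(X <- w) l X)%:C *: nest w.
Proof.
elim: m => [|m IH] /=.
  apply/esym; apply: etrans (big_tuple0 _ (fun w => (\prod_(X <- w) l X)%:C *: nest w)) _.
  by rewrite big_nil scale1r.
rewrite IH [RHS](big_tuple_cons _ m (fun w => (\prod_(X <- w) l X)%:C *: nest w)).
have -> : hamiltonian S h l = \sum_X (l X)%:C *: restr X.
  rewrite /hamiltonian big_mkcond; apply: eq_bigr => X _; rewrite /restr.
  by case: ifP => // _; rewrite scaler0.
rewrite /ad mulmx_suml mulmx_sumr -sumrB; apply: eq_bigr => X _.
rewrite mulmx_sumr mulmx_suml -sumrB; apply: eq_bigr => w _.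
rewrite big_cons rmorphM /= -!scalemxAl -!scalemxAr !scalerA [X in _ - X *: _]mulrC.
by rewrite -scalerBr.
Qed.

Lemma nest_commutes_off : {in S, forall X, supp (h X) = X} -> forall w,
  commutes_off (nest w) (foldr (fun X Y => X :|: Y) (supp A) w)%SET.
Proof.
move=> hS; elim => [|X w IH] /=.
  by move=> Z C CZ; apply: acts_within_commute CZ; apply: acts_within_supp.
apply: commutes_off_ad IH; rewrite /restr; case: ifP => XS Z C CZ XZ.
  by apply: acts_within_commute CZ XZ; rewrite -{2}(hS X XS); apply: acts_within_supp.
by rewrite mul0mx mulmx0.
Qed.

(** If [X] meets neither a letter of [w] nor [supp A], then [h X] commutes with [nest w] by
    [nest_commutes_off]. *)
Lemma nest_cons_neq0 X w : {in S, forall X, supp (h X) = X} ->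
  nest (X :: w) != 0 ->
  [/\ X \in S, nest w != 0 & has (meets X) (rcons w (supp A))].
Proof.
move=> hS n0; have [XS|XS] := boolP (X \in S); last first.
  by move: n0; rewrite /= /restr (negbTE XS) /ad mul0mx mulmx0 subrr eqxx.
split => //.
  by apply: contraNneq n0 => /= ->; rewrite /ad mul0mx mulmx0 subrr.
apply: contraNT n0 => nX; rewrite /= /ad subr_eq0 eq_sym; apply/eqP.
apply: (nest_commutes_off hS (Z := X)).
  by rewrite /restr XS -{2}(hS X XS); apply: acts_within_supp.
elim: w nX => [|Y w IH] /=; rewrite negb_or => /andP[XY nX].
  by apply/eqP; move: XY; rewrite /meets negbK finset.setIC.
rewrite finset.setIUl IH// finset.setU0.
by apply/eqP; move: XY; rewrite /meets negbK finset.setIC.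
Qed.

Lemma nest_neq0 w : {in S, forall X, supp (h X) = X} -> nest w != 0 ->
  {subset w <= S} /\ unsplittable (rcons w (supp A)).
Proof.
move=> hS; elim: w => [|X w IH] n0.
  by split => //; apply: unsplittable1.
have [XS nw Xw] := nest_cons_neq0 hS n0.
have [wS uw] := IH nw; split; last exact: unsplittable_cons.
by move=> Y; rewrite inE => /predU1P[->//|]; apply: wS.
Qed.

Lemma opnorm_nest w : {in S, forall X, opnorm (h X) <= 1} ->
  opnorm (nest w) <= 2 ^+ size w * opnorm A.
Proof.
move=> h1; elim: w => [|X w IH] /=; first by rewrite expr0 mul1r.
apply: le_trans (opnorm_commutator _ _) _.
rewrite exprS -!mulrA ler_wpM2l//.
apply: le_trans (_ : 1 * opnorm (nest w) <= _); last by rewrite mul1r.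
rewrite ler_wpM2r ?opnorm_ge0// /restr; case: ifP => [/h1//|_].
by rewrite opnorm0.
Qed.

Section WeightedSum.
Variable l : {set V} -> R.
Hypotheses (hS : {in S, forall X, supp (h X) = X})
  (h1 : {in S, forall X, opnorm (h X) <= 1})
  (l1 : {in S, forall X, `|l X| <= 1}) (AS : supp A \in S).
Let D := interaction_degree S.

(** Only letters meeting one of the [(size w).+1] subsystems in [rcons w (supp A)] survive, at most
    [D.+1] for each, and a commutator costs a factor 2. *)
Lemma sum_opnorm_nest_cons w :
  \sum_X `|l X| * opnorm (nest (X :: w)) <=
  (size w).+1%:R * D.+1%:R * 2 * opnorm (nest w).
Proof.
have [nw|nw] := eqVneq (nest w) 0.
  rewrite nw opnorm0 mulr0 big1// => X _.
  by rewrite /= nw /ad mul0mx mulmx0 subrr opnorm0 mulr0.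
have [wS _] := nest_neq0 hS nw.
apply: (@le_trans _ _
    (\sum_(X in [set X in S | has (meets X) (rcons w (supp A))]%SET)
        2 * opnorm (nest w))).
  rewrite [leRHS]big_mkcond/=; apply: ler_sum => X _; rewrite inE.
  have [nX|nX] := eqVneq (nest (X :: w)) 0.
    rewrite /= in nX; rewrite nX opnorm0 mulr0; case: ifP => // _.
    by rewrite mulr_ge0 ?opnorm_ge0.
  have [XS _ ->] := nest_cons_neq0 hS nX; rewrite XS/=.
  apply: (@le_trans _ _ (1 * opnorm (ad (restr X) (nest w)))).
    by rewrite ler_wpM2r ?opnorm_ge0 ?l1.
  rewrite mul1r /ad; apply: le_trans (opnorm_commutator _ _) _.
  rewrite ler_wpM2r ?opnorm_ge0// ler_piMr// /restr XS.
  exact: h1.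
rewrite sumr_const -[leLHS]mulr_natl -[leRHS]mulrA.
rewrite ler_wpM2r ?mulr_ge0 ?opnorm_ge0// -natrM ler_nat.
have := @card_has_meets V S (rcons w (supp A)); rewrite size_rcons; apply.
by move=> Y; rewrite mem_rcons inE => /predU1P[->//|]; apply: wS.
Qed.

Lemma sum_opnorm_nest m :
  \sum_(w : m.-tuple {set V}) (\prod_(X <- w) `|l X|) * opnorm (nest w) <=
  m`!%:R * (D.+1%:R * 2) ^+ m * opnorm A.
Proof.
elim: m => [|m IH].
  rewrite (big_tuple0 _ (fun w => (\prod_(X <- w) `|l X|) * opnorm (nest w))).
  by rewrite big_nil !mul1r.
rewrite (big_tuple_cons _ m (fun w => (\prod_(X <- w) `|l X|) * opnorm (nest w))).
(* The tail [w] is fixed first, so that the sum over the outermost letter is bounded for each [w]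
   separately. *)
rewrite exchange_big/=.
apply: (@le_trans _ _ (\sum_(w : m.-tuple {set V}) (\prod_(X <- w) `|l X|) *
    (m.+1%:R * D.+1%:R * 2 * opnorm (nest w)))).
  apply: ler_sum => w _; have := sum_opnorm_nest_cons w; rewrite size_tuple => le.
  have p0 : 0 <= \prod_(X <- w) `|l X| by apply: prodr_ge0.
  apply: le_trans (ler_wpM2l p0 le); rewrite mulr_sumr; apply: ler_sum => X _.
  by rewrite big_cons mulrAC mulrC mulrA.
have c0 : 0 <= m.+1%:R * D.+1%:R * 2 :> R by rewrite !mulr_ge0.
have := ler_wpM2l c0 IH; rewrite mulr_sumr.
under eq_bigr do rewrite mulrCA.
move=> /le_trans; apply; rewrite factS natrM exprS le_eqVlt; apply/orP; left.
by apply/eqP; ring.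
Qed.

End WeightedSum.
End NestedCommutators.

(** * The evolved mean as a word series *)

Section EvolvedMean.
Context (R : realType) (V : finType) (d : nat) (S : {set {set V}}).
Context (h : {set V} -> op R V d) (rho A : op R V d) (t : R[i]).
Hypothesis st : is_state rho.

Definition mean_word (w : seq {set V}) : R[i] := \tr (nest S h A w *m rho).

(** Symmetrized because [tame] requires permutation invariance; the power of ['i * t] depends on the
    length alone. *)
Definition mean_coef (w : seq {set V}) : R[i] :=
  ('i%C * t) ^+ size w * symmetrize mean_word w.

Lemma word_sum_mean_coef m l :
  word_sum m mean_coef l = ('i%C * t) ^+ m * word_sum m mean_word l.
Proof.
rewrite -[in RHS]word_sum_symmetrize [RHS]mulr_sumr; apply: eq_bigr => w _.
by rewrite /mean_coef size_tuple mulrA.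
Qed.

Lemma normc_it m : normc (('i%C * t) ^+ m) = normc t ^+ m.
Proof. by rewrite normcX normcM normcCi normr1 mul1r. Qed.

Lemma word_series_evolved_mean :
  word_series mean_coef (evolved_mean S h rho A t).
Proof.
move=> l; rewrite /evolved_mean scaleNr.
set H := hamiltonian S h l.
have := cvgc_tr_conj ('i%C * t *: H) A st; congr cvgc; apply/funext => n.
apply: eq_bigr => m _; congr (_ * _); rewrite word_sum_mean_coef.
have -> : iter m (ad ('i%C * t *: H)) A = ('i%C * t) ^+ m *: iter m (ad H) A.
  elim: (m : nat) => [|k IH] /=; first by rewrite expr0 scale1r.
  rewrite IH /ad -!scalemxAl -!scalemxAr !scalerA -exprS -exprSr.
  by rewrite -scalerBr.
rewrite -scalemxAl mxtraceZ iter_ad_hamiltonian; congr (_ * _).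
rewrite mulmx_suml raddf_sum; apply: eq_bigr => w _ /=.
by rewrite -scalemxAl mxtraceZ mulrC.
Qed.

Lemma tame_mean_coef : {in S, forall X, opnorm (h X) <= 1} -> tame mean_coef.
Proof.
move=> h1; split=> [w w' ww'|].
  by rewrite /mean_coef (perm_size ww') (symmetrize_perm _ ww').
exists (opnorm A), (normc t * 2); split; rewrite ?opnorm_ge0 ?mulr_ge0 ?normc_ge0//.
move=> w; rewrite normcM normc_it exprMn mulrCA ler_wpM2l ?exprn_ge0 ?normc_ge0//.
apply: normc_symmetrize => v vw; apply: le_trans (normc_tr_state _ st) _.
by rewrite -vw mulrC; apply: opnorm_nest.
Qed.

(** The estimate returns to the unsymmetrized words, where vanishing commutators thin out the sum;
    the [m!] of [sum_opnorm_nest] cancels against [1 / m!]. *)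
Lemma normc_mean_term l m : {in S, forall X, supp (h X) = X} ->
  {in S, forall X, opnorm (h X) <= 1} -> {in S, forall X, `|l X| <= 1} ->
  supp A \in S ->
  normc (m`!%:R^-1 * word_sum m mean_coef l) <=
  (normc t * ((interaction_degree S).+1%:R * 2)) ^+ m * opnorm A.
Proof.
move=> hS h1 l1 AS; rewrite word_sum_mean_coef !normcM normcV normc_nat normc_it.
rewrite ler_pdivrMl ?ltr0n ?fact_gt0// exprMn -mulrA mulrCA.
rewrite ler_wpM2l ?exprn_ge0 ?normc_ge0// mulrA.
apply: le_trans (sum_opnorm_nest hS h1 l1 AS m).
apply: le_trans (normc_sum _ _ _) _; apply: ler_sum => w _.
rewrite normcM normcC normr_prod mulrC ler_wpM2l//; first exact: prodr_ge0.
exact: normc_tr_state.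
Qed.

End EvolvedMean.

(** * The truncation error *)

Lemma sum_geometric_tail_le (R : realFieldType) (x : R) (M n : nat) :
  0 <= x -> x < 1 -> (M <= n)%N ->
  \sum_(M <= m < n) x ^+ m <= x ^+ M / (1 - x).
Proof.
move=> x0 x1 Mn; have y0 : 0 < 1 - x by rewrite subr_gt0.
rewrite ler_pdivlMr//; suff -> : (\sum_(M <= m < n) x ^+ m) * (1 - x) = x ^+ M - x ^+ n.
  by rewrite lerBlDr lerDl exprn_ge0.
rewrite mulr_suml (telescope_sumr_eq (fun m => - x ^+ m) _ Mn).
  by rewrite opprK addrC.
by move=> m _; rewrite exprSr; ring.
Qed.

Theorem proposition3 (R : realType) (V : finType) (d k : nat)
    (S : {set {set V}}) (lambda : {set V} -> R) (h : {set V} -> op R V d)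
    (rho A : op R V d) (t : R[i]) (M : nat) :
  let deg := interaction_degree S in
  let tstar : R := (2 * expR 1 * deg%:R)^-1 in
  let A_ := evolved_mean S h rho A in
  local_hamiltonian k S lambda h ->
  (1 <= deg)%N ->
  is_state rho ->
  supp A \in S ->
  normc t < tstar ->
  normc (A_ t lambda - A_ 0 lambda
         - \sum_(1 <= m < M.+1) \sum_(W \in connected_clusters S (supp A) m)
             (cluster_coef S lambda W / (cluster_fact S W)%:R)%:C
             * cluster_derivative S W (A_ t))
  <= expR 1 * deg%:R * opnorm A
     * ((normc t / tstar) ^+ M.+1 / (1 - normc t / tstar)).
Proof.
move=> deg tstar A_ loc deg1 st AS tt.
have hS : {in S, forall X, supp (h X) = X} by move=> X /loc[].
have h1 : {in S, forall X, opnorm (h X) <= 1} by move=> X /loc[_ _ _ _ ->].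
have l1 : {in S, forall X, `|lambda X| <= 1} by move=> X /loc[].
have expR1_ge2 : 2 <= expR 1 :> R by apply: le_trans (expR_ge1Dx 1); rewrite -natr1.
have deg_ge1 : 1 <= deg%:R :> R by rewrite ler1n.
have tstar_gt0 : 0 < tstar.
  by rewrite invr_gt0 !mulr_gt0 ?expR_gt0// (lt_le_trans ltr01).
set x := normc t / tstar.
have x0 : 0 <= x by rewrite divr_ge0 ?normc_ge0// ltW.
have x1 : x < 1 by rewrite ltr_pdivrMr// mul1r.
(* [deg + 1 <= 2 * deg <= e * deg], so the ratio from [normc_mean_term] is at most [x]. *)
have xb : normc t * (deg.+1%:R * 2) <= x.
  rewrite /x ler_wpM2l ?normc_ge0// /tstar invrK.
  rewrite -natr1; nra.
pose b := mean_coef S h rho A t.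
pose T m := m`!%:R^-1 * word_sum m b lambda.
have TP m : normc (T m) <= x ^+ m * opnorm A.
  apply: le_trans (normc_mean_term t st m hS h1 l1 AS) _.
  rewrite ler_wpM2r ?opnorm_ge0// lerXn2r ?nnegrE//.
  by rewrite !mulr_ge0 ?normc_ge0.
have bT : tame b := tame_mean_coef A t st h1.
have FP := word_series_evolved_mean S h A t st.
(* At time 0 every positive degree vanishes, and the degree 0 coefficient does not depend on the
   time. *)
have A0 : A_ 0 lambda = T 0%N.
  apply/eqP; rewrite -subr_eq0; apply/eqP/eq0_normc/eqP.
  rewrite eq_le normc_ge0 andbT.
  apply: (cvgc_le (N := 1) (word_series_evolved_mean S h A 0 st lambda)) => -[//|n _].
  rewrite big_ord_recl big1 ?addr0 /=; last first.
    by move=> i _; rewrite word_sum_mean_coef mulr0 expr0n mul0r mulr0.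
  by rewrite /T !word_sum_mean_coef !expr0 subrr normc0.
have cluster_term m : (0 < m)%N ->
    \sum_(W \in connected_clusters S (supp A) m)
      (cluster_coef S lambda W / (cluster_fact S W)%:R)%:C
      * cluster_derivative S W (A_ t) = T m.
  move=> m0; rewrite fsbig_finite; last exact: finite_connected_clusters.
  apply: sum_cluster_word bT FP _ _ => [W|w wm bw].
    rewrite in_fset_set; last exact: finite_connected_clusters.
    by move=> Wcc; have [[_ WS] Wm _] := set_mem Wcc.
  rewrite in_fset_set; last exact: finite_connected_clusters.
  apply/mem_set.
  (* A nonzero average has a nonzero member: some rearrangement of [w] has a nonzero nested
     commutator, which makes the multiset of [w] completely connected. *)
  have [v vw] : exists2 v, perm_eq v w & nest S h A v != 0.
    move: bw; rewrite mulf_eq0 negb_or => /andP[_ /symmetrize_neq0[v vw v0]].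
    exists v => //; apply: contraNneq v0 => n0.
    by rewrite /mean_word n0 mul0mx mxtrace0.
  move=> /(nest_neq0 hS)[vS uv].
  have sw : size (seq_mset w) = m by rewrite (perm_size (perm_eq_seq_mset w)).
  split => //; last first.
    rewrite -(eq_seq_msetP _ _ vw); exact: completely_connected_unsplittable.
  split; last first.
    by move=> X; rewrite (perm_mem (perm_eq_seq_mset w)) -(perm_mem vw) => /vS.
  (* The empty multiset is not a cluster; it is excluded by [0 < m]. *)
  apply: contraTneq m0 => w0; rewrite -sw w0.
  by rewrite enum_mset0.
have -> : \sum_(1 <= m < M.+1) \sum_(W \in connected_clusters S (supp A) m)
             (cluster_coef S lambda W / (cluster_fact S W)%:R)%:C
             * cluster_derivative S W (A_ t) = \sum_(1 <= m < M.+1) T m.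
  by apply: eq_big_nat => m /andP[m0 _]; apply: cluster_term.
(* The value at time 0 becomes the degree 0 term of the partial sum. *)
rewrite A0 -addrA -opprD -big_ltn//.
have tail : normc (A_ t lambda - \sum_(0 <= m < M.+1) T m) <=
    opnorm A * (x ^+ M.+1 / (1 - x)).
  apply: (cvgc_le (N := M.+1) (FP lambda)) => n Mn.
  rewrite -(big_mkord xpredT T) (big_cat_nat (leq0n M.+1) Mn)/= addrAC subrr add0r.
  apply: le_trans (normc_sum _ _ _) _.
  apply: (@le_trans _ _ (\sum_(M.+1 <= m < n) opnorm A * x ^+ m)).
    by apply: ler_sum => m _; rewrite mulrC.
  by rewrite -mulr_sumr ler_wpM2l ?opnorm_ge0// sum_geometric_tail_le.
apply: le_trans tail _; rewrite ler_wpM2r//.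
  by rewrite divr_ge0 ?exprn_ge0// subr_ge0 ltW.
(* The tail carries the constant [opnorm A], and [e * deg >= 1]. *)
rewrite ler_peMl ?opnorm_ge0//.
nra.
Qed.
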